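(* Let $\rho^{A_1\ldots A_mE}$ be an $(m+1)$-partite quantum state and for each $j\in[m]$ let $M^j=\{M^j_{x_j}\}_{x_j\in\mathcal{X}_j}$ be a POVM on $A_j$. Define $$\omega'=\sum_{x_1,\ldots,x_m}|x_{[m]}\rangle\langle x_{[m]}|^{X_{[m]}}\otimes\mathrm{Tr}_{A_1\ldots A_m}\big[\rho^{A_1\ldots A_mE}(M^1_{x_1}\otimes\cdots\otimes M^m_{x_m}\otimes\mathbb{1}_E)\big].$$ Let $\mathcal{R}_{\mathrm{c}}$ be the set of rate tuples $R_{[m]}=(R_1,\ldots,R_m)$ such that for every $I\subsetneq[m]$, $\sum_{j\in I}R_j\ge H(X_I|X_{[m]\setminus I})_{\omega'}$, and let $R^{\mathrm{c}}_{\mathrm{CO}}=\min_{R_{[m]}\in\mathcal{R}_{\mathrm{c}}}\sum_{i=1}^mR_i$. Then $$K_{\mathrm{n.i.}}(\rho)\ \ge\ S(X_{[m]}|E)_{\omega'}-R^{\mathrm{c}}_{\mathrm{CO}}.$$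
   Context: Notation: $[m]=\{1,\ldots,m\}$; $X_I=(X_j:j\in I)$; $H$ is Shannon (conditional) entropy of the joint distribution $p(x_{[m]})=\mathrm{Tr}\,\rho(M^1_{x_1}\otimes\cdots\otimes M^m_{x_m}\otimes\mathbb{1}_E)$; $S(A|B)=S(AB)-S(B)$ with von Neumann entropy $S$; $\log$ base 2. Non-interactive secret key agreement: $m$ legitimate players and an eavesdropper share $n$ copies $\rho^{\otimes n}$, player $j$ holding $A_j^n$ and the eavesdropper $E^n$. A protocol consists of (1) for each player $j$ an instrument $\{\mathcal{E}^{(j)}_{\ell_j}\}_{\ell_j\in\mathcal{L}_j}$ of completely positive maps $A_j^n\to A_j'$ summing to a trace-preserving map, with $|\mathcal{L}_j|\le 2^{nR_j}$ for some constants $R_j$; player $j$ applies it and publicly broadcasts $\ell_j$ (the eavesdropper receives a copy of all messages); (2) for each $j$ and each tuple $\ell_{[m]}$ a POVM $(D^{(j,\ell_{[m]})}_{k_j})_{k_j\in\mathcal{K}}$ on $A_j'$, whose outcome $k_j$ is player $j$'s key. The resulting state is $$\Omega^{K_1\ldots K_mL_{[m]}E^n}=\sum_{k_{[m]},\ell_{[m]}}|k_1\rangle\langle k_1|\otimes\cdots\otimes|k_m\rangle\langle k_m|\otimes|\ell_{[m]}\rangle\langle\ell_{[m]}|\otimes\mathrm{Tr}_{A'_{[m]}}\Big[\big((\textstyle\bigotimes_j\mathcal{E}^{(j)}_{\ell_j})\otimes\mathrm{id}_{E^n}\big)(\rho^{\otimes n})\,\big(\textstyle\bigotimes_j D^{(j,\ell_{[m]})}_{k_j}\otimes\mathbb{1}_{E^n}\big)\Big].$$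 It is an $(n,\varepsilon)$-protocol if $\Pr\{K_1=\cdots=K_m\}\ge1-\varepsilon$ and $\frac12\|\Omega^{K_1L_{[m]}E^n}-u_{K_1}\otimes\tau_0^{L_{[m]}E^n}\|_1\le\varepsilon$ for some fixed state $\tau_0$, where $u_{K_1}=\frac1{|\mathcal{K}|}\sum_{k}|k\rangle\langle k|$. $R$ is achievable if for all $n$ there are $(n,\varepsilon_n)$-protocols with $\varepsilon_n\to0$ and $\frac1n\log|\mathcal{K}|\to R$. The non-interactive secret-key capacity is $K_{\mathrm{n.i.}}(\rho)=\sup\{R: R\text{ achievable}\}$. *)

(* Defs.v *)
From HB Require Import structures.
From mathcomp Require Import all_boot all_order all_algebra.
From mathcomp Require Import all_classical all_reals all_analysis.
From mathcomp Require Import complex.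

Set Implicit Arguments.
Unset Strict Implicit.
Unset Printing Implicit Defensive.

Import Order.TTheory GRing.Theory Num.Theory.
Import numFieldNormedType.Exports.
Local Open Scope ring_scope.
Local Open Scope classical_set_scope.

(* A system is described by a finite type T (an orthonormal basis); an        *)
(* operator on it is a T x T complex matrix given by its entries.             *)

Section QM.
Variable R : realType.
Local Notation C := (R[i]).

Definition op (T : finType) := T -> T -> C.

Definition opid (T : finType) : op T := fun i j => (i == j)%:R.
Definition opmul (T : finType) (A B : op T) : op T :=
  fun i k => \sum_j A i j * B j k.
Definition opsub (T : finType) (A B : op T) : op T := fun i j => A i j - B i j.
Definition opadj (T : finType) (A : op T) : op T := fun i j => Num.conj (A j i).
Definition optrace (T : finType) (A : op T) : C := \sum_i A i i.

Definition optensor (S T : finType) (A : op S) (B : op T) : op (S * T)%type :=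
  fun x y => A x.1 y.1 * B x.2 y.2.

Definition optensorn (I : finType) (T : I -> finType) (A : forall i, op (T i))
  : op {dffun forall i, T i} :=
  fun x y => \prod_i A i (x i) (y i).

Definition ptrace1 (S T : finType) (A : op (S * T)%type) : op T :=
  fun t t' => \sum_s A (s, t) (s, t').
Definition ptrace2 (S T : finType) (A : op (S * T)%type) : op S :=
  fun s s' => \sum_t A (s, t) (s', t).

Definition optpow (n : nat) (T : finType) (A : op T) : op {ffun 'I_n -> T} :=
  fun x y => \prod_(t < n) A (x t) (y t).

Definition psd (T : finType) (A : op T) : Prop :=
  forall v : T -> C, 0 <= \sum_i \sum_j Num.conj (v i) * A i j * v j.
Definition is_state (T : finType) (A : op T) : Prop :=
  psd A /\ optrace A = 1.
Definition is_povm (T X : finType) (M : X -> op T) : Prop :=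
  (forall x, psd (M x)) /\ (forall i j, \sum_x M x i j = opid (T:=T) i j).

(* Linear maps op S -> op T, given by the images of the matrix units |s><s'| *)
Definition lmap (S T : finType) := S -> S -> op T.
Definition lapply (S T : finType) (F : lmap S T) (A : op S) : op T :=
  fun t t' => \sum_s \sum_s' A s s' * F s s' t t'.
Definition lmap_id (S : finType) : lmap S S :=
  fun s s' t t' => ((t == s) && (t' == s'))%:R.
Definition lmap_tensor (S1 T1 S2 T2 : finType) (F : lmap S1 T1) (G : lmap S2 T2)
  : lmap (S1 * S2)%type (T1 * T2)%type :=
  fun s s' t t' => F s.1 s'.1 t.1 t'.1 * G s.2 s'.2 t.2 t'.2.
Definition lmap_tensorn (I : finType) (S T : I -> finType)
  (F : forall i, lmap (S i) (T i)) : lmap {dffun forall i, S i} {dffun forall i, T i} :=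
  fun s s' t t' => \prod_i F i (s i) (s' i) (t i) (t' i).
Definition lmap_sum (S T L : finType) (F : L -> lmap S T) : lmap S T :=
  fun s s' t t' => \sum_l F l s s' t t'.

Definition is_cp (S T : finType) (F : lmap S T) : Prop :=
  forall (k : nat) (A : op ('I_k * S)%type),
    psd A -> psd (lapply (lmap_tensor (lmap_id (S:='I_k)) F) A).
Definition is_tp (S T : finType) (F : lmap S T) : Prop :=
  forall A : op S, optrace (lapply F A) = optrace A.
Definition is_instrument (S T L : finType) (F : L -> lmap S T) : Prop :=
  (forall l, is_cp (F l)) /\ is_tp (lmap_sum F).

Definition mx_of (T : finType) (A : op T) : matrix C #|T| #|T| :=
  \matrix_(i, j) A (enum_val i) (enum_val j).

Lemma char_poly_splits (n : nat) (M : matrix C n n) :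
  exists s : seq C, char_poly M == \prod_(z <- s) ('X - z%:P).
Proof.
have [r Hr] := closed_field_poly_normal (char_poly M).
exists r; apply/eqP; rewrite {1}Hr.
by have /monicP -> := char_poly_monic M; rewrite scale1r.
Qed.

Definition eigs (T : finType) (A : op T) : seq C :=
  xchoose (char_poly_splits (mx_of A)).

Definition log2 (x : R) : R := ln x / ln 2.
Definition eta (x : R) : R := if x == 0 then 0 else - (x * log2 x).

Definition vN (T : finType) (A : op T) : R := \sum_(l <- eigs A) eta (complex.Re l).

Definition tnorm (T : finType) (A : op T) : R :=
  \sum_(l <- eigs (opmul (opadj A) A)) Num.sqrt (complex.Re l).

Definition shannon (T : finType) (p : T -> R) : R := \sum_t eta (p t).

End QM.

Section Setting.
Variable R : realType.
Local Notation C := (R[i]).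
Variable m : nat.
Variable d : 'I_m -> nat.
Variable dE : nat.

Definition sysA := {dffun forall j : 'I_m, 'I_(d j)}.
Definition sysAE := (sysA * 'I_dE)%type.

Section CQ.
Variable X : 'I_m -> finType.
Variable rho : op R sysAE.
Variable M : forall j, X j -> op R 'I_(d j).

Definition Xall := {dffun forall j, X j}.

Definition cq_block (x : Xall) : op R 'I_dE :=
  ptrace1 (opmul rho (optensor (optensorn (fun j : 'I_m => @M j (x j))) (@opid R 'I_dE))).

Definition omega' : op R (Xall * 'I_dE)%type :=
  fun u v => if u.1 == v.1 then cq_block u.1 u.2 v.2 else 0.

Definition pX (x : Xall) : R :=
  complex.Re (optrace (opmul rho (optensor (optensorn (fun j : 'I_m => @M j (x j))) (@opid R 'I_dE)))).

Definition SXgivenE : R := vN omega' - vN (ptrace1 omega').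

(* X_J, encoded injectively as the tuple with unknown entries outside J *)
Definition restr (J : {set 'I_m}) (x : Xall) : {dffun forall j, option (X j)} :=
  [ffun j => if j \in J then Some (x j) else None].

Definition HX (J : {set 'I_m}) : R :=
  shannon (fun y => \sum_(x | restr J x == y) pX x).
Definition HXcond (I : {set 'I_m}) : R := HX (I :|: ~: I) - HX (~: I).

Definition Rc : set ('I_m -> R) :=
  [set Rt | forall I : {set 'I_m}, I \proper [set: 'I_m] ->
     HXcond I <= \sum_(j in I) Rt j].
Definition RCO : \bar R := ereal_inf [set (\sum_j Rt j)%:E | Rt in Rc].

End CQ.

Definition sysAn (n : nat) := {dffun forall j : 'I_m, {ffun 'I_n -> 'I_(d j)}}.
Definition sysEn (n : nat) := {ffun 'I_n -> 'I_dE}.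

Definition regroup (n : nat) (z : (sysAn n * sysEn n)%type) : {ffun 'I_n -> sysAE} :=
  [ffun t => ([ffun j => z.1 j t] : sysA, z.2 t)].

Definition rho_n (n : nat) (rho : op R sysAE) : op R (sysAn n * sysEn n)%type :=
  fun z z' => optpow (n:=n) rho (regroup z) (regroup z').

Record protocol (n : nat) := Protocol {
  pK : finType;                                  (* key alphabet K *)
  pL : 'I_m -> finType;                          (* message sets L_j *)
  pd' : 'I_m -> nat;                             (* dimension of A'_j *)
  pinst : forall j, pL j -> lmap R {ffun 'I_n -> 'I_(d j)} 'I_(pd' j);
  pdec : forall j, {dffun forall i, pL i} -> pK -> op R 'I_(pd' j)
}.

Section Protocol.
Variable n : nat.
Variable P : protocol n.
Local Notation K := (pK P).
Local Notation Lt := {dffun forall i, pL P i}.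

Definition valid_protocol : Prop :=
  (forall j, is_instrument (@pinst n P j)) /\
  (forall j (l : Lt), is_povm (@pdec n P j l)).

Definition out_block (rho : op R sysAE) (k : {ffun 'I_m -> K}) (l : Lt) : op R (sysEn n) :=
  ptrace1 (opmul
    (lapply (lmap_tensor (lmap_tensorn (fun j : 'I_m => @pinst n P j (l j))) (@lmap_id R (sysEn n)))
            (rho_n (n:=n) rho))
    (optensor (optensorn (fun j : 'I_m => @pdec n P j l (k j))) (@opid R (sysEn n)))).

Definition Omega (rho : op R sysAE) : op R ({ffun 'I_m -> K} * (Lt * sysEn n))%type :=
  fun u v => if (u.1 == v.1) && (u.2.1 == v.2.1) then out_block rho u.1 u.2.1 u.2.2 v.2.2
             else 0.

Definition keep_key (j : 'I_m) (U : finType) (A : op R ({ffun 'I_m -> K} * U)%type) : op R (K * U)%type :=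
  fun u v => \sum_(x : {ffun 'I_m -> K} | x j == u.1)
             \sum_(y : {ffun 'I_m -> K} | (y j == v.1) && [forall i, (i != j) ==> (y i == x i)])
               A (x, u.2) (y, v.2).

Definition unif : op R K := fun k k' => (k == k')%:R / #|K|%:R.

Definition eps_protocol (rho : op R sysAE) (eps : R) : Prop :=
  valid_protocol /\
  1 - eps <= \sum_(k : {ffun 'I_m -> K} | [forall i, forall i', k i == k i'])
               \sum_(l : Lt) complex.Re (optrace (out_block rho k l)) /\
  (* secrecy of K_1 (the player with index 0) *)
  (forall j0 : 'I_m, nat_of_ord j0 = 0%N ->
     exists tau0 : op R (Lt * sysEn n)%type, is_state tau0 /\
       tnorm (opsub (keep_key j0 (Omega rho)) (optensor unif tau0)) / 2 <= eps).

End Protocol.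

Definition achievable (rho : op R sysAE) (r : R) : Prop :=
  exists (Rmsg : 'I_m -> R) (eps : nat -> R) (P : forall n, protocol n),
    [/\ forall n, eps_protocol (P n) rho (eps n),
        forall n (j : 'I_m), (#|pL (P n) j|%:R : R) <= 2 `^ (n%:R * Rmsg j),
        eps @ \oo --> (0 : R) &
        (fun n : nat => log2 (#|pK (P n)|%:R) / (n%:R : R)) @ \oo --> (r : R)].

Definition Kni (rho : op R sysAE) : \bar R :=
  ereal_sup [set r%:E | r in achievable rho].

End Setting.

(* Main.v *)
(* Every player measures all its copies, publishes a hash f_j of its string
   x_j^n and stores x_j^n. By random binning, messages of rate
   R_j + 3 delta with R in R_c let every player recover the whole tuple x^n (up
   to small error), and the key is a random hash g of x^n.

   For secrecy, no smooth entropies are needed. Diagonalise each block of omega'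
   as sum_i lam(x,i) |v_xi><v_xi|, and rho_E as sum_j mu_j |e_j><e_j|. For n
   copies the eigenvalues are products, so by the law of large numbers almost
   all the weight sits on y = (x,i)^n with prod lam <= 2^(-n(S(XE) - delta)) and
   on at most 2^(n(S(E) + delta)) eigenvectors e_j. The trace distance is Tr(W D)
   for a unitary W, where D is block diagonal in (key, messages). Restrict D to
   typical y and project on typical e_j, on one side only; Cauchy-Schwarz then
   bounds Tr(W D) by sqrt(#K #L #{typical j} sum_(k,l) |D_kl|_2^2), and the
   average over g of the last sum is at most sum_(typical y) lam_y^2. This tends
   to 0 as soon as the key rate plus the communication rate is below S(X|E). *)
Require Import Defs.
From HB Require Import structures.
From mathcomp Require Import all_boot all_order all_algebra.
From mathcomp Require Import all_classical all_reals all_analysis.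
From mathcomp Require Import complex ring lra.
Import Order.TTheory GRing.Theory Num.Theory.
Local Open Scope ring_scope.

Set Implicit Arguments.
Unset Strict Implicit.
Unset Printing Implicit Defensive.
Import numFieldNormedType.Exports.
Local Open Scope complex_scope.

(** * Finite sums and the spectral theorem *)

(** The two random choices are made one after the other: the binning [f] is fixed first, for its
    decoding error alone, and [g] is then drawn for that [f]. This works because the secrecy
    estimate holds for every message map: messages enter only through the number of blocks, and this
    is what charges the communication rate against the key rate. The sign operator W depends on [g],
    so [g] has to be chosen through a quantity that does not involve W; the sum of squared
    Hilbert-Schmidt norms is such a quantity. In its expansion over pairs of eigenvectors, pairs
    from different strings average to zero, since two distinct inputs collide with probability
    exactly 1/#K, and pairs from the same string vanish, since eigenvectors of one block are
    orthogonal. Only the diagonal remains. A player hashes the string that it decodes, not the true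
    one. Both correctness and secrecy are therefore reduced to the key [g xs] of the true string, at
    a cost controlled by the probability of a decoding failure. *)

(** Distributivity over dependent functions: an average over independent choices, one per player,
    becomes a product. *)
Lemma sum_dffun_prod (K : comNzRingType) (I : finType) (T_ : I -> finType)
    (P : forall i, T_ i -> K) :
  \sum_(t : {dffun forall i, T_ i}) \prod_i P i (t i) = \prod_i \sum_(j : T_ i) P i j.
Proof.
rewrite (reindex (@dffun_of_fprod I T_)); last exact/onW_bij/dffun_of_fprod_bij.
under eq_bigr => t _ do under eq_bigr => i _ do rewrite /dffun_of_fprod ffunE.
have /= E := @big_fprod K 0 1 *%R +%R I T_ (fun i => [ffun j => P i j]).
transitivity (\sum_(t : fprod T_) \prod_(i in I) [ffun j => P i j] (t i)).
  by apply: eq_bigr => t _; apply: eq_bigr => i _; rewrite ffunE.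
rewrite {}E.
have := @bigA_distr_big_dep K 0 1 *%R +%R I {i : I & T_ i} (tagged_with T_)
  (fun i => untag 0 ([ffun j => P i j] : T_ i -> K)).
move=> /= <-; apply: eq_bigr => i _.
transitivity (\sum_(j : T_ i) [ffun j => P i j] j).
  by rewrite (big_tag (fun i => [ffun j => P i j] : T_ i -> K)).
by apply: eq_bigr => j _; rewrite ffunE.
Qed.

Lemma card_dffun_prod (K : comNzRingType) (I : finType) (T_ : I -> finType) :
  #|{: {dffun forall i, T_ i}}|%:R = \prod_i #|T_ i|%:R :> K.
Proof.
rewrite -sum1_card natr_sum.
transitivity (\sum_(t : {dffun forall i, T_ i}) \prod_i (fun i (_ : T_ i) => 1 : K) i (t i)).
  by apply: eq_big => // t _; rewrite big1.
rewrite (sum_dffun_prod (fun i (_ : T_ i) => 1 : K)).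
by apply: eq_bigr => i _; rewrite -sum1_card natr_sum; apply: eq_bigl.
Qed.

Lemma sum_pair (V : nmodType) (S T : finType) (F : S * T -> V) :
  \sum_p F p = \sum_s \sum_t F (s, t).
Proof. by rewrite pair_bigA; apply: eq_bigr => -[]. Qed.

Lemma sum_delta (K : pzRingType) (T : finType) (F : T -> K) i :
  \sum_k (k == i)%:R * F k = F i.
Proof.
rewrite (bigD1 i) //= eqxx mul1r big1 ?addr0 // => k /negbTE ->.
by rewrite mul0r.
Qed.

Lemma sum_delta_r (K : pzRingType) (T : finType) (F : T -> K) i :
  \sum_k F k * (k == i)%:R = F i.
Proof.
rewrite (bigD1 i) //= eqxx mulr1 big1 ?addr0 // => k /negbTE ->.
by rewrite mulr0.
Qed.

Section LinearAlgebra.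
Variable R : realType.
Local Notation C := (R[i]).

Definition eigdec (T : finType) (A : op R T) (lam : T -> R) (u : T -> T -> C) :=
  [/\ forall i j, A i j = \sum_t (lam t)%:C * u t i * Num.conj (u t j),
      forall s t, \sum_i Num.conj (u s i) * u t i = (s == t)%:R &
      forall i j, \sum_t u t i * Num.conj (u t j) = (i == j)%:R].

Definition selfadjoint (T : finType) (A : op R T) := forall i j, A j i = Num.conj (A i j).

Lemma eigdec_exists (T : finType) (A : op R T) :
  selfadjoint A -> exists lam u, eigdec A lam u.
Proof.
move=> hA; pose M := mx_of A.
have hM : M \is hermsymmx.
  apply/is_hermitianmxP; rewrite expr0 scale1r; apply/matrixP => i j.
  by rewrite !mxE hA.
have Ddiag := orthomx_spectralP (hermitian_normalmx hM).
have Dreal := hermitian_spectral_diag_real hM.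
have Punit := spectral_unitarymx M.
set P := spectralmx M in Ddiag Punit; set D := spectral_diag M in Ddiag Dreal.
have PPt := unitarymxP Punit.
have PtP : map_mx Num.conj P^T *m P = 1%:M by apply: mulmx1C.
rewrite invmx_unitary // in Ddiag.
exists (fun t => complex.Re (D 0 (enum_rank t))).
(* The decomposition reads M = P^* D P with P unitary, so the eigenvectors are the columns of P^*,
   that is, the conjugated rows of P. *)
exists (fun t i => Num.conj (P (enum_rank t) (enum_rank i))).
have reE (f : 'I_#|T| -> C) : \sum_t f (enum_rank t) = \sum_k f k.
  rewrite [RHS](reindex (@enum_rank T)) //.
  by apply/onW_bij/enum_rank_bij.
split=> [i j|s t|i j].
- have /matrixP/(_ (enum_rank i) (enum_rank j)) := Ddiag.
  rewrite !mxE !enum_rankK => ->.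
  under eq_bigr => k _.
    rewrite mul_mx_diag !mxE; over.
  rewrite -(reE (fun k => _)); apply: eq_bigr => t _.
  rewrite RRe_real; last exact: (mxOverP Dreal).
  by rewrite conjCK [_ * D _ _]mulrC.
- have /matrixP/(_ (enum_rank s) (enum_rank t)) := PPt.
  rewrite !mxE (can_eq enum_rankK) => <-.
  rewrite -(reE (fun k => _)); apply: eq_bigr => k _.
  by rewrite !mxE conjCK.
- have /matrixP/(_ (enum_rank i) (enum_rank j)) := PtP.
  rewrite !mxE (can_eq enum_rankK) => <-.
  rewrite -(reE (fun k => _)); apply: eq_bigr => k _.
  by rewrite !mxE conjCK.
Qed.

(** Polarisation: [0 <= z] in C forces z to be real, and the quadratic form at e_i + c e_j with c =
    1 and c = i determines the real and imaginary parts of the off-diagonal entries. *)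
Lemma psd_hermitian (T : finType) (A : op R T) : psd A -> selfadjoint A.
Proof.
move=> hA.
pose v (i j : T) (c : C) (k : T) : C := (k == i)%:R + (k == j)%:R * c.
have q i j c : \sum_k \sum_l Num.conj (v i j c k) * A k l * v i j c l =
    A i i + A i j * c + Num.conj c * A j i + Num.conj c * A j j * c.
  transitivity (\sum_k Num.conj (v i j c k) * (A k i + A k j * c)).
    apply: eq_bigr => k _.
    transitivity (\sum_l Num.conj (v i j c k) *
                   ((l == i)%:R * A k l + (l == j)%:R * (A k l * c))).
      by apply: eq_bigr => l _; rewrite /v; ring.
    by rewrite -mulr_sumr big_split /= !sum_delta.
  under eq_bigr => k _ do rewrite /v rmorphD rmorphM !rmorph_nat mulrDl -mulrA.
  by rewrite big_split /= !sum_delta mulrDr !mulrA !addrA.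
have real0 (z : C) : 0 <= z -> Num.conj z = z by move=> /ger0_real/CrealP.
have diag i : Num.conj (A i i) = A i i.
  by apply: real0; have := hA (v i i 0); rewrite q !(mulr0, rmorph0, mul0r, addr0).
move=> i j.
have h1 := real0 _ (hA (v i j 1)).
have h2 := real0 _ (hA (v i j 'i)).
move: h1 h2; rewrite !q !rmorphD !rmorphM !rmorph1 !conjCi !rmorphN /= !conjCi.
rewrite !diag !mulr1 !mul1r.
set a := A i j; set b := A j i; set a' := Num.conj a; set b' := Num.conj b.
set x := A i i; set y := A j j => h1 h2.
have e1 : a' + b' = a + b by apply: (addrI x); apply: (addIr y); rewrite !addrA.
have e2 : - ('i * a') + 'i * b' = 'i * a - 'i * b.
  apply: (addrI x); apply: (addIr (y : C)).
  move: h2; rewrite opprK !mulrN !mulNr -!mulrA (mulrC y) !mulrA -expr2 sqrCi !mulN1r !opprK.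
  by rewrite (mulrC a') (mulrC a) !addrA.
have e3 : b' - a' = a - b.
  by apply: (mulfI (neq0Ci C)); rewrite !mulrBr addrC e2.
have : b + b = a' + a'.
  have -> : b + b = (a + b) - (a - b) by ring.
  by rewrite -e1 -e3; ring.
by rewrite -!mulr2n => /eqP; rewrite eqr_pMn2r // => /eqP.
Qed.

Lemma psd_diag_ge0 (T : finType) (A : op R T) i : psd A -> 0 <= A i i.
Proof.
move=> /(_ (fun k => (k == i)%:R)).
under eq_bigr => k _ do rewrite sum_delta_r rmorph_nat.
by rewrite sum_delta.
Qed.

(** [eigs] is an arbitrary choice of roots of the characteristic polynomial, hence known only up to
    order. Similarity to a diagonal matrix is used in the form A V = V D, after which the
    determinant of V cancels. *)
Lemma perm_eigs (T : finType) (A : op R T) lam u :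
  eigdec A lam u -> perm_eq (eigs A) [seq (lam t)%:C | t <- enum T].
Proof.
move=> [hA ho hc]; apply: prod_XsubC_eq.
have /eqP <- := xchooseP (char_poly_splits (mx_of A)).
pose V : 'M[C]_#|T| := \matrix_(i, j) u (enum_val j) (enum_val i).
pose D : 'rV[C]_#|T| := \row_j (lam (enum_val j))%:C.
have evE (f : T -> C) : \sum_(k < #|T|) f (enum_val k) = \sum_t f t.
  by rewrite [RHS](reindex (@enum_val T T)) //; exact/onW_bij/enum_val_bij.
have AV : mx_of A *m V = V *m diag_mx D.
  apply/matrixP => i k; rewrite mul_mx_diag !mxE.
  under eq_bigr => j _ do rewrite !mxE hA mulr_suml.
  rewrite exchange_big /=.
  transitivity (\sum_s (lam s)%:C * u s (enum_val i) * (s == enum_val k)%:R).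
    apply: eq_bigr => s _; rewrite -ho mulr_sumr -evE.
    by apply: eq_bigr => j _; rewrite !mulrA.
  under eq_bigr => s _ do rewrite mulrC.
  by rewrite sum_delta mulrC.
have Vunit : V \in unitmx.
  suff /mulmx1_unit[]: map_mx Num.conj V^T *m V = 1%:M by [].
  apply/matrixP => i k; rewrite !mxE.
  under eq_bigr => j _ do rewrite !mxE.
  rewrite (evE (fun t => Num.conj (u (enum_val i) t) * u (enum_val k) t)) ho.
  by rewrite (can_eq enum_valK).
have -> : char_poly (mx_of A) = char_poly (diag_mx D).
  have dV : \det (map_mx polyC V) != 0.
    by rewrite det_map_mx polyC_eq0 -unitfE.
  apply: (mulIf dV); rewrite /char_poly -det_mulmx mulrC -det_mulmx.
  congr (\det _); rewrite /char_poly_mx mulmxBl mulmxBr -!map_mxM AV.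
  by rewrite scalar_mxC.
rewrite char_poly_trig ?diag_mx_is_trig // big_map big_enum /=.
rewrite [RHS](reindex (@enum_val T T)) /=; last exact/onW_bij/enum_val_bij.
by apply: eq_bigr => k _; rewrite !mxE eqxx mulr1n.
Qed.
End LinearAlgebra.

(** * Entropy and trace norm in terms of a spectral decomposition *)

Section Eigenvalues.
Variable R : realType.
Local Notation C := (R[i]).

Lemma conj_real (x : R) : Num.conj (x%:C) = x%:C :> C.
Proof. exact: conjc_real. Qed.

Lemma eigdec_ge0 (T : finType) (A : op R T) lam u :
  psd A -> eigdec A lam u -> forall t, 0 <= lam t.
Proof.
move=> pA [hA ho hc] t; have := pA (u t).
suff -> : \sum_i \sum_j Num.conj (u t i) * A i j * u t j = (lam t)%:C.
  by rewrite ler0c.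
transitivity (\sum_s (s == t)%:R * ((lam s)%:C * \sum_i Num.conj (u t i) * u s i)).
  under eq_bigr => i _ do under eq_bigr => j _ do rewrite hA mulr_sumr mulr_suml.
  under eq_bigr => i _ do rewrite exchange_big /=.
  rewrite exchange_big /=; apply: eq_bigr => s _.
  rewrite -ho mulrCA [X in _ * X]mulrC big_distrlr /= mulr_sumr; apply: eq_bigr => i _.
  by rewrite mulr_sumr; apply: eq_bigr => j _; ring.
by rewrite sum_delta ho eqxx mulr1.
Qed.

Lemma vN_eigdec (T : finType) (A : op R T) lam u :
  eigdec A lam u -> vN A = \sum_t Defs.eta (lam t).
Proof.
move=> hA; rewrite /vN (perm_big _ (perm_eigs hA)) /= big_map big_enum /=; exact: eq_bigl.
Qed.

Lemma eigdec_sqr (T : finType) (A : op R T) lam u :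
  eigdec A lam u -> eigdec (opmul (opadj A) A) (fun t => lam t ^+ 2) u.
Proof.
move=> [hA ho hc]; split=> // i k; rewrite /opmul /opadj.
under eq_bigr => j _ do rewrite !hA raddf_sum /= big_distrlr /=.
rewrite exchange_big /=; apply: eq_bigr => s _.
rewrite exchange_big /=.
transitivity (\sum_t (t == s)%:R * ((lam s)%:C * u s i * (lam t)%:C * Num.conj (u t k))).
  apply: eq_bigr => t _; rewrite eq_sym -ho mulr_suml; apply: eq_bigr => j _.
  by rewrite !rmorphM /= conj_real conjCK; ring.
by rewrite sum_delta rmorphXn /= expr2; ring.
Qed.

Lemma tnorm_eigdec (T : finType) (A : op R T) lam u :
  eigdec A lam u -> tnorm A = \sum_t `|lam t|.
Proof.
move=> hA; rewrite /tnorm (perm_big _ (perm_eigs (eigdec_sqr hA))) /= big_map big_enum /=.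
by apply: eq_bigr => t _; rewrite sqrtr_sqr.
Qed.

(* W is the sign of A. *)
Lemma tnorm_dual (T : finType) (A : op R T) : selfadjoint A ->
  exists W : op R T,
    (forall i j, \sum_k Num.conj (W k i) * W k j = (i == j)%:R) /\
    (tnorm A)%:C = \sum_i \sum_j W i j * A j i.
Proof.
move=> hA; have [lam [u hu]] := eigdec_exists hA; have [eA ho hc] := hu.
(* The sign is 1 on the kernel too, so that W is unitary and not merely a partial isometry. *)
pose s t : R := if 0 <= lam t then 1 else -1.
have s2 t : s t * s t = 1 by rewrite /s; case: ifP => _; ring.
exists (fun i j => \sum_t (s t)%:C * u t i * Num.conj (u t j)); split.
  move=> i j; rewrite -hc.
  under eq_bigr => k _ do rewrite raddf_sum /= big_distrlr /=.
  rewrite exchange_big /=; apply: eq_bigr => t _; rewrite exchange_big /=.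
  transitivity (\sum_r (r == t)%:R * ((s t)%:C * (s r)%:C * u t i * Num.conj (u r j))).
    apply: eq_bigr => r _; rewrite eq_sym -ho mulr_suml; apply: eq_bigr => k _.
    by rewrite !rmorphM /= conj_real conjCK; ring.
  by rewrite sum_delta -rmorphM s2 mul1r.
rewrite (tnorm_eigdec hu).
transitivity (\sum_t \sum_r (r == t)%:R * ((s t)%:C * (lam r)%:C * \sum_i (Num.conj (u r i) * u t i))).
  rewrite rmorph_sum; apply: eq_bigr => t _ /=.
  rewrite sum_delta ho eqxx mulr1 -rmorphM /s; case: ifP => h0.
    by rewrite mul1r ger0_norm.
  by rewrite mulN1r ler0_norm // ltW // real_ltNge ?num_real ?h0.
transitivity (\sum_i \sum_j \sum_t \sum_r ((s t)%:C * u t i * Num.conj (u t j) *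
   ((lam r)%:C * u r j * Num.conj (u r i)))); last first.
  by apply: eq_bigr => i _; apply: eq_bigr => j _; rewrite eA big_distrlr.
under [RHS]eq_bigr => i _ do rewrite exchange_big /=.
rewrite [RHS]exchange_big /=; apply: eq_bigr => t _.
under [RHS]eq_bigr => i _ do rewrite exchange_big /=.
rewrite [RHS]exchange_big /=; apply: eq_bigr => r _.
rewrite eq_sym -ho mulrCA [X in _ * X]mulrC big_distrlr /= mulr_sumr.
apply: eq_bigr => i _; rewrite mulr_sumr; apply: eq_bigr => j _.
by ring.
Qed.
End Eigenvalues.

(** * Positive operators as Gram matrices *)

Section Factor.
Variable R : realType.
Local Notation C := (R[i]).

(** Products of Gram matrices are visibly Gram matrices, which gives positivity of tensor products;
    the index set [S] is left free so that it can become a product itself. *)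
Definition factored (T : finType) (A : op R T) :=
  exists (S : finType) (B : S -> T -> C),
    forall i j, A i j = \sum_s B s i * Num.conj (B s j).

Lemma psd_factored (T : finType) (A : op R T) : psd A -> factored A.
Proof.
move=> pA; have [lam [u hu]] := eigdec_exists (psd_hermitian pA).
have l0 := eigdec_ge0 pA hu; have [eA ho hc] := hu.
exists T, (fun s i => (Num.sqrt (lam s))%:C * u s i) => i j.
rewrite eA; apply: eq_bigr => t _.
rewrite -[in LHS](sqr_sqrtr (l0 t)) rmorphXn /= rmorphM /= conj_real; ring.
Qed.

Lemma factored_psd (T : finType) (A : op R T) : factored A -> psd A.
Proof.
move=> [S [B eA]] v.
suff -> : \sum_i \sum_j Num.conj (v i) * A i j * v j =
    \sum_s (\sum_i Num.conj (v i) * B s i) * Num.conj (\sum_i Num.conj (v i) * B s i).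
  by apply: sumr_ge0 => s _; exact: mul_conjC_ge0.
under [RHS]eq_bigr => s _ do rewrite raddf_sum /= big_distrlr /=.
rewrite [RHS]exchange_big /=; apply: eq_bigr => i _.
rewrite [RHS]exchange_big /=; apply: eq_bigr => j _.
rewrite eA mulr_sumr mulr_suml; apply: eq_bigr => s _.
by rewrite rmorphM /= conjCK; ring.
Qed.

Lemma factored_family (I : Type) (T : I -> finType) (A : forall i, op R (T i)) :
  (forall i, factored (A i)) ->
  exists (S : I -> finType) (B : forall i, S i -> T i -> C),
    forall i x y, A i x y = \sum_s B i s x * Num.conj (B i s y).
Proof.
move=> /choice[S hS]; exists S.
pose B i := projT1 (cid (hS i)); exists B => i; exact: (projT2 (cid (hS i))).
Qed.

Lemma factored_tensorn (I : finType) (T : I -> finType) (A : forall i, op R (T i)) :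
  (forall i, psd (A i)) -> factored (optensorn A).
Proof.
move=> pA; have [S [B hB]] := factored_family (fun i => psd_factored (pA i)).
exists {dffun forall i, S i}.
exists (fun (s : {dffun forall i, S i}) (x : {dffun forall i, T i}) =>
  \prod_i B i (s i) (x i)) => x y.
under [RHS]eq_bigr => s _ do rewrite rmorph_prod -big_split /=.
rewrite (@sum_dffun_prod _ _ _ (fun i s => B i s (x i) * Num.conj (B i s (y i)))).
by apply: eq_bigr => i _; exact: hB.
Qed.

Lemma factored_tpow (I T : finType) (A : I -> op R T) :
  (forall i, psd (A i)) ->
  factored (fun x y : {ffun I -> T} => \prod_i A i (x i) (y i)).
Proof.
move=> pA; have [S [B hB]] := factored_family (fun i => psd_factored (pA i)).
exists {dffun forall i, S i}.
exists (fun (s : {dffun forall i, S i}) (x : {ffun I -> T}) =>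
  \prod_i B i (s i) (x i)) => x y.
under [RHS]eq_bigr => s _ do rewrite rmorph_prod -big_split /=.
rewrite (@sum_dffun_prod _ _ _ (fun i s => B i s (x i) * Num.conj (B i s (y i)))).
by apply: eq_bigr => i _; exact: hB.
Qed.

(** Writing M as a sum of rank-one terms turns the partial trace of A (1 tensor M) into a sum of
    compressions of A, tested on the product vectors [w q]. It serves both the blocks of [omega']
    and complete positivity of the measurement. *)
Lemma psd_ptrace_mul (K S : finType) (A : op R (K * S)%type) (M : op R S) :
  psd A -> factored M ->
  psd (fun k k' => \sum_s \sum_s' A (k, s) (k', s') * M s' s).
Proof.
move=> pA [Q [B eM]] v.
pose w q (z : K * S) : C := v z.1 * B q z.2.
suff -> : \sum_i \sum_j Num.conj (v i) * (\sum_s \sum_s' A (i, s) (j, s') * M s' s) * v j =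
    \sum_q \sum_x \sum_y Num.conj (w q x) * A x y * w q y.
  by apply: sumr_ge0 => q _; exact: pA.
transitivity (\sum_i \sum_j \sum_s \sum_s' \sum_q
   Num.conj (w q (i, s)) * A (i, s) (j, s') * w q (j, s')).
  apply: eq_bigr => i _; apply: eq_bigr => j _.
  rewrite mulr_sumr mulr_suml; apply: eq_bigr => s _.
  rewrite mulr_sumr mulr_suml; apply: eq_bigr => s' _.
  rewrite eM mulr_sumr mulr_sumr mulr_suml; apply: eq_bigr => q _.
  by rewrite /w /= rmorphM /=; ring.
transitivity (\sum_i \sum_j \sum_s \sum_q \sum_s'
   Num.conj (w q (i, s)) * A (i, s) (j, s') * w q (j, s')).
  by do 3![apply: eq_bigr => ? _]; rewrite exchange_big.
transitivity (\sum_i \sum_j \sum_q \sum_s \sum_s'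
   Num.conj (w q (i, s)) * A (i, s) (j, s') * w q (j, s')).
  by do 2![apply: eq_bigr => ? _]; rewrite exchange_big.
transitivity (\sum_q \sum_i \sum_j \sum_s \sum_s'
   Num.conj (w q (i, s)) * A (i, s) (j, s') * w q (j, s')).
  rewrite [RHS]exchange_big; apply: eq_bigr => i _.
  by rewrite [RHS]exchange_big.
apply: eq_bigr => q _.
transitivity (\sum_i \sum_s \sum_j \sum_s'
   Num.conj (w q (i, s)) * A (i, s) (j, s') * w q (j, s')).
  by apply: eq_bigr => i _; rewrite exchange_big.
rewrite pair_bigA /=; apply: eq_bigr => -[i s] _ /=.
by rewrite pair_bigA /=; apply: eq_bigr => -[j s'] _.
Qed.

End Factor.

(** * Inner products and contractions *)

Section InnerProduct.
Variable R : realType.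
Local Notation C := (R[i]).

(** Lagrange's identity: twice the gap is a sum of squares. *)
Lemma cauchy_schwarz_sum (T : finType) (a b : T -> R) :
  (\sum_i a i * b i) ^+ 2 <= (\sum_i a i ^+ 2) * (\sum_i b i ^+ 2).
Proof.
have : 0 <= \sum_i \sum_j (a i * b j - a j * b i) ^+ 2.
  by apply: sumr_ge0 => i _; apply: sumr_ge0 => j _; exact: sqr_ge0.
suff -> : \sum_i \sum_j (a i * b j - a j * b i) ^+ 2 =
   ((\sum_i a i ^+ 2) * (\sum_i b i ^+ 2) - (\sum_i a i * b i) ^+ 2) *+ 2.
  by rewrite pmulrn_lge0 // subr_ge0.
set a2 := \sum_i a i ^+ 2; set b2 := \sum_i b i ^+ 2; set ab := \sum_i a i * b i.
transitivity (a2 * b2 + b2 * a2 - (ab * ab + ab * ab)); last by ring.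
rewrite !big_distrlr /= -!big_split -sumrB /=; apply: eq_bigr => i _.
rewrite -!big_split -sumrB /=; apply: eq_bigr => j _.
by ring.
Qed.

(** The norm on [R[i]] takes its values in [R[i]]; this is the same number as an element of [R]. *)
Definition cabs (z : C) : R := complex.Re `|z|.

Lemma cabsE z : (cabs z)%:C = `|z|.
Proof. by rewrite RRe_real // normr_real. Qed.

Lemma cabs_ge0 z : 0 <= cabs z.
Proof. by rewrite -ler0c cabsE normr_ge0. Qed.

Lemma cabsM z w : cabs (z * w) = cabs z * cabs w.
Proof. by apply: complexI; rewrite rmorphM /= !cabsE normrM. Qed.

Lemma cabs_conj z : cabs (Num.conj z) = cabs z.
Proof. by apply: complexI; rewrite !cabsE norm_conjC. Qed.

Lemma cabs_real (x : R) : cabs x%:C = `|x|.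
Proof.
apply: complexI; rewrite cabsE.
case: (lerP 0 x) => h; first by rewrite !ger0_norm ?ler0c.
by rewrite !ltr0_norm ?ltcR // rmorphN.
Qed.

Lemma cabs_sum (I : finType) (P : pred I) (F : I -> C) :
  cabs (\sum_(i | P i) F i) <= \sum_(i | P i) cabs (F i).
Proof.
rewrite -lecR cabsE rmorph_sum /=.
under [leRHS]eq_bigr => i _ do rewrite cabsE.
exact: ler_norm_sum.
Qed.

Lemma cabsD z w : cabs (z + w) <= cabs z + cabs w.
Proof. by rewrite -lecR rmorphD /= !cabsE ler_normD. Qed.

Lemma sqr_cabs z : (cabs z ^+ 2)%:C = z * Num.conj z.
Proof. by rewrite rmorphXn /= cabsE normCK. Qed.

Definition inner (T : finType) (v w : T -> C) : C := \sum_i Num.conj (v i) * w i.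
Definition norm2 (T : finType) (v : T -> C) : R := \sum_i cabs (v i) ^+ 2.
Definition apply_op (T : finType) (A : op R T) (v : T -> C) : T -> C :=
  fun i => \sum_j A i j * v j.
Definition op_contraction (T : finType) (A : op R T) :=
  forall v, norm2 (apply_op A v) <= norm2 v.

Lemma norm2E (T : finType) (v : T -> C) : (norm2 v)%:C = inner v v.
Proof. by rewrite rmorph_sum; apply: eq_bigr => i _; rewrite /= sqr_cabs mulrC. Qed.

Lemma norm2_ge0 (T : finType) (v : T -> C) : 0 <= norm2 v.
Proof. by apply: sumr_ge0 => i _; exact: sqr_ge0. Qed.

Lemma inner_conj (T : finType) (v w : T -> C) : Num.conj (inner v w) = inner w v.
Proof.
rewrite rmorph_sum; apply: eq_bigr => i _ /=.
by rewrite rmorphM /= conjCK mulrC.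
Qed.

Lemma inner_le (T : finType) (v w : T -> C) :
  cabs (inner v w) <= Num.sqrt (norm2 v) * Num.sqrt (norm2 w).
Proof.
apply: le_trans (cabs_sum _ _) _.
under eq_bigr => i _ do rewrite cabsM cabs_conj.
rewrite -sqrtrM ?norm2_ge0 // -[leLHS]ger0_norm; last first.
  by apply: sumr_ge0 => i _; rewrite mulr_ge0 ?cabs_ge0.
by rewrite -sqrtr_sqr ler_wsqrtr // cauchy_schwarz_sum.
Qed.

Lemma inner_contraction (T : finType) (A : op R T) (v w : T -> C) :
  op_contraction A ->
  cabs (inner v (apply_op A w)) <= Num.sqrt (norm2 v) * Num.sqrt (norm2 w).
Proof.
move=> cA; apply: le_trans (inner_le _ _) _.
by rewrite ler_wpM2l ?sqrtr_ge0 // ler_wsqrtr.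
Qed.

(** Extend the vector by zero outside block b, apply the isometry W, and forget the other blocks of
    the result: only the last operation can change the norm, and it decreases it. *)
Lemma contraction_block (B T : finType) (W : op R (B * T)%type) (b : B) :
  (forall i j, \sum_k Num.conj (W k i) * W k j = (i == j)%:R) ->
  op_contraction (fun e e' => W (b, e) (b, e')).
Proof.
move=> uW v; pose w (z : B * T) : C := (z.1 == b)%:R * v z.2.
have isoW (x : B * T -> C) : norm2 (apply_op W x) = norm2 x.
  apply: complexI; rewrite !norm2E.
  transitivity (\sum_i \sum_j (i == j)%:R * (Num.conj (x i) * x j)).
    rewrite /inner /apply_op.
    under eq_bigr => k _ do rewrite raddf_sum /= big_distrlr /=.
    rewrite exchange_big /=; apply: eq_bigr => i _.
    rewrite exchange_big /=; apply: eq_bigr => j _.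
    rewrite -uW mulr_suml; apply: eq_bigr => k _.
    by rewrite rmorphM /=; ring.
  apply: eq_bigr => i _; under eq_bigr => j _ do rewrite eq_sym.
  by rewrite sum_delta.
have -> : norm2 v = norm2 w.
  rewrite /norm2 /w sum_pair /=.
  rewrite (bigD1 b) //= eqxx [X in _ + X]big1 ?addr0.
    by apply: eq_bigr => e _; rewrite mul1r.
  move=> c /negbTE ->; apply: big1 => e _.
  by rewrite mul0r -[0]/(0%:C) cabs_real normr0 expr0n.
rewrite -isoW /norm2 [leRHS]sum_pair /=.
rewrite (bigD1 b) //= -[leLHS]addr0 lerD //; last first.
  by apply: sumr_ge0 => c _; apply: sumr_ge0 => e _; exact: sqr_ge0.
apply: ler_sum => e _; rewrite /apply_op.
suff -> : \sum_j W (b, e) (b, j) * v j = \sum_j W (b, e) j * w j by [].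
rewrite [RHS]sum_pair /=.
rewrite (bigD1 b) //= [X in _ + X]big1 ?addr0.
  by apply: eq_bigr => f _; rewrite /w /= eqxx mul1r.
move=> c /negbTE h; apply: big1 => f _.
by rewrite /w /= h mul0r mulr0.
Qed.

End InnerProduct.

(** * Privacy amplification *)

Section PrivacyAmplification.
Variable R : realType.
Local Notation C := (R[i]).

Lemma inner_sumr (I E : finType) (P : pred I) (v : E -> C) (w : I -> E -> C) :
  inner v (fun i => \sum_(j | P j) w j i) = \sum_(j | P j) inner v (w j).
Proof.
by rewrite /inner exchange_big /=; apply: eq_bigr => i _; rewrite mulr_sumr.
Qed.

Lemma innerZr (E : finType) (v w : E -> C) (a : C) :
  inner v (fun i => a * w i) = a * inner v w.
Proof. by rewrite /inner mulr_sumr; apply: eq_bigr => i _; rewrite mulrCA. Qed.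

Lemma apply_op_lin (I E : finType) (P : pred I) (A : op R E) (a : I -> C) (w : I -> E -> C) :
  apply_op A (fun i => \sum_(j | P j) a j * w j i) =
  fun i => \sum_(j | P j) a j * apply_op A (w j) i.
Proof.
apply/funext => i; rewrite /apply_op.
under eq_bigr => k _ do rewrite mulr_sumr.
rewrite exchange_big /=; apply: eq_bigr => j _.
by rewrite mulr_sumr; apply: eq_bigr => k _; rewrite mulrCA.
Qed.

Definition orthobasis (J E : finType) (e : J -> E -> C) :=
  (forall s t, inner (e s) (e t) = (s == t)%:R) /\
  (forall i k, \sum_t e t i * Num.conj (e t k) = (i == k)%:R).

Lemma parseval (J E : finType) (e : J -> E -> C) (v w : E -> C) :
  orthobasis e -> \sum_j inner v (e j) * inner (e j) w = inner v w.
Proof.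
move=> [_ hc]; under eq_bigr => j _ do rewrite /inner big_distrlr /=.
rewrite exchange_big /=; apply: eq_bigr => i _.
rewrite exchange_big /=.
transitivity (\sum_k (k == i)%:R * (Num.conj (v i) * w k)); last by rewrite sum_delta.
apply: eq_bigr => k _; rewrite eq_sym -hc mulr_suml; apply: eq_bigr => j _.
by ring.
Qed.

Lemma basis_expand (J E : finType) (e : J -> E -> C) (v : E -> C) :
  orthobasis e -> v = fun i => \sum_j inner (e j) v * e j i.
Proof.
move=> [_ hc]; apply/funext => i.
under eq_bigr => j _ do rewrite mulr_suml.
rewrite exchange_big /=.
transitivity (\sum_k (k == i)%:R * v k); first by rewrite sum_delta.
apply: eq_bigr => k _; rewrite eq_sym -hc mulr_suml; apply: eq_bigr => j _.
by ring.
Qed.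

Lemma norm2_comb (J E : finType) (e : J -> E -> C) (P : pred J) (a : J -> C) :
  orthobasis e ->
  norm2 (fun i => \sum_(j | P j) a j * e j i) = \sum_(j | P j) cabs (a j) ^+ 2.
Proof.
move=> [ho _]; apply: complexI; rewrite norm2E inner_sumr rmorph_sum /=.
apply: eq_bigr => j Pj; rewrite innerZr -inner_conj inner_sumr.
rewrite rmorph_sum /= (bigD1 j) //= innerZr ho eqxx mulr1 big1 ?addr0.
  by rewrite sqr_cabs.
by move=> k /andP[_ /negbTE kj]; rewrite innerZr ho eq_sym kj mulr0 rmorph0.
Qed.

(** Cauchy-Schwarz for the vectors sqrt w and sqrt (w f). *)
Lemma sqrt_jensen (Y : finType) (w f : Y -> R) :
  (forall y, 0 <= w y) -> \sum_y w y = 1 -> (forall y, 0 <= f y) ->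
  \sum_y w y * Num.sqrt (f y) <= Num.sqrt (\sum_y w y * f y).
Proof.
move=> w0 w1 f0.
rewrite -[leLHS]ger0_norm; last by apply: sumr_ge0 => y _; rewrite mulr_ge0 ?sqrtr_ge0.
rewrite -sqrtr_sqr ler_wsqrtr //.
have := cauchy_schwarz_sum (fun y => Num.sqrt (w y)) (fun y => Num.sqrt (w y) * Num.sqrt (f y)).
under eq_bigr => y _ do rewrite mulrA -expr2 sqr_sqrtr //.
under [X in _ <= X * _]eq_bigr => y _ do rewrite sqr_sqrtr //.
under [X in _ <= _ * X]eq_bigr => y _ do rewrite exprMn !sqr_sqrtr //.
by rewrite w1 mul1r.
Qed.

Section Core.
Variables (E Y X J B : finType) (w : Y -> R) (v : Y -> E -> C) (p : Y -> X).
Variables (e : J -> E -> C) (G : pred J) (H : pred Y) (c : B -> X -> R).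
Variables (W : B -> op R E) (al : R).
Hypothesis w0 : forall y, 0 <= w y.
Hypothesis w1 : \sum_y w y = 1.
Hypothesis v1 : forall y, norm2 (v y) = 1.
Hypothesis be : orthobasis e.
Hypothesis cW : forall b, op_contraction (W b).
Hypothesis cal : forall x, \sum_b `|c b x| <= al.

(** The image of e j under block b of the difference operator, restricted to the typical y. *)
Let A b j : E -> C :=
  fun i => \sum_(y | H y) ((c b (p y) * w y)%:C * inner (v y) (e j)) * v y i.

Let r y : E -> C := fun i => \sum_(j | ~~ G j) inner (e j) (v y) * e j i.

Let eps y : R := \sum_(j | ~~ G j) cabs (inner (e j) (v y)) ^+ 2.

(** The sum over b of the squared Hilbert-Schmidt norms of the restricted blocks. Computed in the
    basis e, it is the sum of [norm2 (A b j)] over all j, which dominates the sum over good j. *)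
Let D : R := \sum_b \sum_(y | H y) \sum_(y' | H y')
  c b (p y) * c b (p y') * w y * w y' * cabs (inner (v y) (v y')) ^+ 2.

Let sum_norm2A : \sum_b \sum_j norm2 (A b j) = D.
Proof.
apply: eq_bigr => b _; apply: complexI; rewrite rmorph_sum /=.
under eq_bigr => j _ do rewrite norm2E inner_sumr.
rewrite exchange_big /= rmorph_sum /=; apply: eq_bigr => y Hy.
under eq_bigr => j _ do rewrite innerZr -(inner_conj (v y)) inner_sumr rmorph_sum mulr_sumr /=.
rewrite exchange_big /= rmorph_sum /=; apply: eq_bigr => y' Hy'.
under eq_bigr => j _ do rewrite innerZr !rmorphM /= !conj_real !inner_conj.
rewrite rmorphM /= sqr_cabs !rmorphM /= inner_conj -{1}(parseval (v y) (v y') be).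
rewrite mulr_suml mulr_sumr; apply: eq_bigr => j _.
by ring.
Qed.

Let good_part : cabs (\sum_b \sum_(j | G j) inner (A b j) (apply_op (W b) (e j)))
  <= Num.sqrt (#|B|%:R * #|G|%:R * D).
Proof.
pose s b j := Num.sqrt (norm2 (A b j)).
have D0 : 0 <= D.
  rewrite -sum_norm2A; apply: sumr_ge0 => b _; apply: sumr_ge0 => j _.
  exact: norm2_ge0.
apply: (@le_trans _ _ (\sum_b \sum_(j | G j) s b j)).
  apply: le_trans (cabs_sum _ _) _; apply: ler_sum => b _.
  apply: le_trans (cabs_sum _ _) _; apply: ler_sum => j _.
  have := inner_contraction (A b j) (e j) (cW b).
  suff -> : norm2 (e j) = 1 by rewrite sqrtr1 mulr1.
  by apply: complexI; rewrite norm2E be.1 eqxx.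
rewrite -[leLHS]ger0_norm; last first.
  by apply: sumr_ge0 => b _; apply: sumr_ge0 => j _; exact: sqrtr_ge0.
rewrite -sqrtr_sqr ler_wsqrtr //.
have := cauchy_schwarz_sum (fun q : B * J => (G q.2)%:R) (fun q => s q.1 q.2).
rewrite !sum_pair /=.
have -> : \sum_(b : B) \sum_j (G j)%:R * s b j = \sum_b \sum_(j | G j) s b j.
  apply: eq_bigr => b _; rewrite [RHS]big_mkcond /=; apply: eq_bigr => j _.
  by case: (G j); rewrite ?mul1r ?mul0r.
have -> : \sum_(b : B) \sum_j (G j)%:R ^+ 2 = #|B|%:R * #|G|%:R :> R.
  rewrite sumr_const -[LHS]mulr_natl; congr (_ * _).
  rewrite -sum1_card natr_sum [RHS]big_mkcond /=; apply: eq_bigr => j _.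
  by rewrite unfold_in; case: (G j); rewrite ?expr1n ?expr0n.
suff -> : \sum_b \sum_j s b j ^+ 2 = D by [].
rewrite -sum_norm2A; apply: eq_bigr => b _; apply: eq_bigr => j _.
by rewrite /s sqr_sqrtr ?norm2_ge0.
Qed.

(* Atypical y contribute the first tail. For typical y, the part of v y outside
   the span of the e j with G j contributes the square root of the second; the
   rest is sum_(G j) <A_b e_j | W_b e_j>, treated by Cauchy-Schwarz in (b, j). *)
Lemma privacy_split :
  cabs (\sum_b \sum_y (c b (p y) * w y)%:C * inner (v y) (apply_op (W b) (v y)))
  <= al * (\sum_(y | ~~ H y) w y + Num.sqrt (\sum_y w y * eps y))
     + Num.sqrt (#|B|%:R * #|G|%:R * D).
Proof.
have split b y : inner (v y) (apply_op (W b) (v y)) =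
    \sum_(j | G j) inner (e j) (v y) * inner (v y) (apply_op (W b) (e j))
    + inner (v y) (apply_op (W b) (r y)).
  rewrite {2}(basis_expand (v y) be) /r !apply_op_lin !inner_sumr.
  rewrite (bigID G) /=; congr (_ + _); apply: eq_bigr => j _; exact: innerZr.
have bound b y z : cabs (inner (v y) (apply_op (W b) z)) <= Num.sqrt (norm2 z).
  by have := inner_contraction (v y) z (cW b); rewrite v1 sqrtr1 mul1r.
have -> : \sum_b \sum_y (c b (p y) * w y)%:C * inner (v y) (apply_op (W b) (v y)) =
    \sum_b \sum_(y | ~~ H y) (c b (p y) * w y)%:C * inner (v y) (apply_op (W b) (v y))
  + \sum_b \sum_(y | H y) (c b (p y) * w y)%:C * inner (v y) (apply_op (W b) (r y))
  + \sum_b \sum_(j | G j) inner (A b j) (apply_op (W b) (e j)).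
  rewrite -!big_split /=; apply: eq_bigr => b _.
  rewrite (bigID H) /= addrC -addrA; congr (_ + _).
  have -> : \sum_(j | G j) inner (A b j) (apply_op (W b) (e j)) =
     \sum_(y | H y) \sum_(j | G j) (c b (p y) * w y)%:C *
        (inner (e j) (v y) * inner (v y) (apply_op (W b) (e j))).
    rewrite [RHS]exchange_big /=; apply: eq_bigr => j _.
    rewrite -(inner_conj (apply_op _ _)) inner_sumr rmorph_sum /=; apply: eq_bigr => y _.
    by rewrite innerZr !rmorphM /= !inner_conj !conj_real; ring.
  rewrite -big_split /=; apply: eq_bigr => y _.
  by rewrite split mulrDr mulr_sumr addrC.
apply: le_trans (cabsD _ _) _; apply: lerD; last exact: good_part.
have term b y z : cabs ((c b (p y) * w y)%:C * inner (v y) (apply_op (W b) z)) <=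
   `|c b (p y)| * (w y * Num.sqrt (norm2 z)).
  rewrite cabsM cabs_real normrM (ger0_norm (w0 y)) -mulrA.
  by rewrite ler_wpM2l // ler_wpM2l.
have exch (P : pred Y) (f : Y -> R) : (forall y, 0 <= f y) ->
   \sum_b \sum_(y | P y) `|c b (p y)| * f y <= al * \sum_(y | P y) f y.
  move=> f0; rewrite exchange_big /= mulr_sumr; apply: ler_sum => y _.
  by rewrite -mulr_suml ler_wpM2r.
apply: le_trans (cabsD _ _) _; rewrite mulrDr; apply: lerD.
  apply: le_trans (exch (fun y => ~~ H y) w w0).
  apply: le_trans (cabs_sum _ _) _; apply: ler_sum => b _.
  apply: le_trans (cabs_sum _ _) _; apply: ler_sum => y _.
  by apply: le_trans (term _ _ _) _; rewrite v1 sqrtr1 mulr1.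
(* Nonnegativity of [al] comes from [cal] at some point of X; one exists because the weights sum to
   1, so that Y is inhabited. *)
have al0 (x : X) : 0 <= al by apply: le_trans (cal x); apply: sumr_ge0.
apply: (@le_trans _ _ (al * \sum_y w y * Num.sqrt (eps y))); last first.
  have [y0 _|Y0] := pickP Y; last first.
    by move: w1; rewrite big1 => [/eqP|y]; [rewrite eq_sym oner_eq0|move: (Y0 y)].
  rewrite ler_wpM2l ?(al0 (p y0)) // sqrt_jensen // => y.
  by apply: sumr_ge0 => j _; exact: sqr_ge0.
have f0 y : 0 <= w y * Num.sqrt (eps y) by rewrite mulr_ge0 ?sqrtr_ge0.
apply: le_trans (exch xpredT _ f0).
apply: le_trans (cabs_sum _ _) _; apply: ler_sum => b _.
apply: le_trans (cabs_sum _ _) _; rewrite big_mkcond /=; apply: ler_sum => y _.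
case: (H y); last by rewrite mulr_ge0.
apply: le_trans (term _ _ _) _; rewrite (_ : norm2 (r y) = eps y) //.
exact: norm2_comb.
Qed.

End Core.
End PrivacyAmplification.

(** * Random hash functions *)

Section RandomFunctions.
Variable R : realType.
Local Notation C := (R[i]).

Lemma exists_le_mean (I : finType) (F : I -> R) (M : R) :
  (0 < #|I|)%N -> \sum_i F i <= #|I|%:R * M -> exists i, F i <= M.
Proof.
move=> I0 hF; apply/not_existsP => hn.
have : \sum_(i : I) M < \sum_i F i.
  apply: ltr_sum => [|i _]; last by rewrite ltNge; apply/negP; exact: hn.
  by have /card_gt0P[i _] := I0; apply/hasP; exists i; rewrite ?mem_index_enum.
by rewrite sumr_const -[X in X < _]mulr_natl ltNge hF.
Qed.

(* (g, k) |-> (g with value k at x, g x) is an involution turning the event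
   g x = g x' into k = g x'. *)
Lemma sum_collision (X K : finType) (x x' : X) : x != x' ->
  \sum_(g : {ffun X -> K}) (g x == g x')%:R * #|K|%:R = #|{ffun X -> K}|%:R :> R.
Proof.
move=> xx'.
pose upd (g : {ffun X -> K}) k : {ffun X -> K} := [ffun z => if z == x then k else g z].
pose h (q : {ffun X -> K} * K) := (upd q.1 q.2, q.1 x).
have hK : involutive h.
  move=> [g k]; rewrite /h /upd /=; congr pair; last by rewrite ffunE eqxx.
  by apply/ffunP => z; rewrite !ffunE; case: eqP => [->|].
transitivity (\sum_(q : {ffun X -> K} * K) (q.1 x == q.1 x')%:R : R).
  rewrite sum_pair; apply: eq_bigr => g _ /=.
  by rewrite sumr_const -[RHS]mulr_natr.
rewrite (reindex_inj (inv_inj hK)) sum_pair /=.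
rewrite -sum1_card natr_sum; apply: eq_bigr => g _.
rewrite -[RHS](sum_delta (fun=> 1) (g x')); apply: eq_bigr => k _.
by rewrite /upd !ffunE eqxx (eq_sym x') (negbTE xx') mulr1.
Qed.

(* Coefficient of x in the block (key, message) = b of the difference between
   the real state and (uniform key) (x) (side information). *)
Definition hash_coef (X L K : finType) (f : X -> L) (g : X -> K) (b : K * L) (x : X) : R :=
  (f x == b.2)%:R * ((g x == b.1)%:R - #|K|%:R^-1).

(** The sum over keys has two mixed terms, each equal to -1/#K, and #K constant terms 1/#K^2, which
    leaves -1/#K. *)
Lemma sum_hash_coef (X L K : finType) (f : X -> L) (g : X -> K) (x x' : X) :
  (0 < #|K|)%N ->
  \sum_b hash_coef f g b x * hash_coef f g b x' =
  (f x == f x')%:R * ((g x == g x')%:R - #|K|%:R^-1).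
Proof.
move=> K0; have K0R : #|K|%:R != 0 :> R by rewrite pnatr_eq0 -lt0n.
rewrite sum_pair exchange_big /=.
transitivity (\sum_l (l == f x)%:R * ((f x' == l)%:R *
   \sum_k ((g x == k)%:R - #|K|%:R^-1) * ((g x' == k)%:R - #|K|%:R^-1)) : R).
  apply: eq_bigr => l _; rewrite mulr_sumr mulr_sumr; apply: eq_bigr => k _.
  by rewrite /hash_coef /= (eq_sym l); ring.
rewrite sum_delta eq_sym; congr (_ * _).
transitivity (\sum_k ((k == g x)%:R * (g x' == k)%:R - (k == g x)%:R * #|K|%:R^-1
     - (k == g x')%:R * #|K|%:R^-1 + #|K|%:R^-1 * #|K|%:R^-1) : R).
  apply: eq_bigr => k _; rewrite !(eq_sym k); ring.
rewrite big_split !sumrB /= !sum_delta sumr_const -[X in _ + X]mulr_natl eq_sym.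
by rewrite mulrA mulfV // mul1r subrK.
Qed.

(** Only the message [f x] contributes: at most 1 from the hashed key and 1 from the uniform one.
    This is the constant [al] in [privacy_split]. *)
Lemma sum_norm_hash_coef (X L K : finType) (f : X -> L) (g : X -> K) (x : X) :
  (0 < #|K|)%N -> \sum_b `|hash_coef f g b x| <= 2.
Proof.
move=> K0; have K0R : #|K|%:R != 0 :> R by rewrite pnatr_eq0 -lt0n.
rewrite sum_pair exchange_big /=.
apply: (@le_trans _ _ (\sum_l (l == f x)%:R *
   \sum_k ((k == g x)%:R * 1 + #|K|%:R^-1) : R)).
  apply: ler_sum => l _; rewrite mulr_sumr; apply: ler_sum => k _.
  rewrite /hash_coef /= (eq_sym l) normrM normr_nat ler_wpM2l // mulr1 (eq_sym k).
  by apply: le_trans (ler_normB _ _) _; rewrite normr_nat ger0_norm ?invr_ge0.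
rewrite sum_delta big_split /= sum_delta sumr_const -[X in _ + X]mulr_natl.
by rewrite mulfV.
Qed.

(** Mean over g. If [p y] and [p y'] differ, the collision probability is exactly 1/#K and the term
    averages to zero; if they agree and y, y' differ, orthogonality kills it. A diagonal term
    carries the factor 1 - 1/#K, bounded by 1. *)
Lemma exists_good_hash (E Y X L K : finType) (w : Y -> R) (v : Y -> E -> C) (p : Y -> X)
    (H : pred Y) (f : X -> L) :
  (0 < #|K|)%N -> (forall y, norm2 (v y) = 1) ->
  (forall y y', p y = p y' -> y != y' -> inner (v y) (v y') = 0) ->
  exists g : {ffun X -> K},
    \sum_(b : K * L) \sum_(y | H y) \sum_(y' | H y')
       hash_coef f g b (p y) * hash_coef f g b (p y') * w y * w y' *
       cabs (inner (v y) (v y')) ^+ 2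
    <= \sum_(y | H y) w y ^+ 2.
Proof.
move=> K0 v1 vo; have K0R : #|K|%:R != 0 :> R by rewrite pnatr_eq0 -lt0n.
apply: exists_le_mean.
  by rewrite card_ffun expn_gt0 K0.
under eq_bigr => g _.
  rewrite exchange_big /=.
  under eq_bigr => y _.
    rewrite exchange_big /=.
    under eq_bigr => y' _ do rewrite -!mulr_suml sum_hash_coef //.
    over.
  over.
rewrite exchange_big /= mulr_sumr; apply: ler_sum => y Hy.
rewrite exchange_big /= (bigD1 y) //= [X in _ + X]big1 ?addr0.
  rewrite /cabs -norm2E v1 normr1 /= expr1n.
  have -> : #|{ffun X -> K}|%:R * w y ^+ 2 = \sum_(g : {ffun X -> K}) w y ^+ 2.
    by rewrite sumr_const [LHS]mulr_natl.
  apply: ler_sum => g _.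
  rewrite !eqxx mul1r mulr1 -mulrA -expr2 ler_piMl ?sqr_ge0 //.
  by rewrite gerBl invr_ge0.
move=> y' /andP[_ yy']; have [pp|pp] := eqVneq (p y) (p y').
  apply: big1 => g _; rewrite vo ?(eq_sym y) // /cabs normr0 /= expr0n /= mulr0.
  by [].
rewrite -!mulr_suml -mulr_sumr sumrB sumr_const -[X in _ - X]mulr_natl.
rewrite -(sum_collision K pp) -mulr_suml mulfK // subrr.
by rewrite mulr0 !mul0r.
Qed.
End RandomFunctions.

(** * The law of large numbers on finite product spaces *)

Section LawOfLargeNumbers.
Variable R : realType.
Local Open Scope classical_set_scope.

Definition distribution_on (T : finType) (p : T -> R) :=
  (forall x, 0 <= p x) /\ \sum_x p x = 1.

Definition prodp (T : finType) (p : T -> R) n (xs : {ffun 'I_n -> T}) : R :=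
  \prod_t p (xs t).

(** At n = 0 every string deviates; this is harmless, since tails are only used in the limit. *)
Definition deviates (T : finType) (Z : T -> R) (h delta : R) n (xs : {ffun 'I_n -> T}) : bool :=
  n%:R * delta <= `|\sum_t Z (xs t) - n%:R * h|.

Definition tail (T : finType) (p : T -> R) (Z : T -> R) (h delta : R) n : R :=
  \sum_(xs : {ffun 'I_n -> T} | deviates Z h delta xs) prodp p xs.

Lemma prodp_ge0 (T : finType) (p : T -> R) n (xs : {ffun 'I_n -> T}) :
  (forall x, 0 <= p x) -> 0 <= prodp p xs.
Proof. by move=> p0; apply: prodr_ge0. Qed.

Lemma sum_prodp (T : finType) (p : T -> R) n :
  \sum_x p x = 1 -> \sum_(xs : {ffun 'I_n -> T}) prodp p xs = 1.
Proof. by move=> p1; rewrite -(bigA_distr_bigA (fun _ => p)) p1 big1. Qed.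

Lemma prodp_second_moment (T : finType) (p z : T -> R) n :
  \sum_x p x = 1 -> \sum_x p x * z x = 0 ->
  \sum_(xs : {ffun 'I_n -> T}) prodp p xs * (\sum_t z (xs t)) ^+ 2 =
  n%:R * \sum_x p x * z x ^+ 2.
Proof.
move=> p1 z0.
(* The r-th factor of the term (s, t): it carries one z for each of s, t equal to r. For distinct s
   and t the factor at s has mean zero, so only s = t survives. *)
pose F (s t r : 'I_n) x := p x * ((if r == s then z x else 1) * (if r == t then z x else 1)).
have EF s t (xs : {ffun 'I_n -> T}) :
    prodp p xs * (z (xs s) * z (xs t)) = \prod_r F s t r (xs r).
  rewrite !big_split /= -!big_mkcond /=.
  by rewrite !big_pred1_eq.
transitivity (\sum_s \sum_t \prod_(r < n) \sum_x F s t r x).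
  under eq_bigr => xs _ do rewrite expr2 big_distrlr mulr_sumr /=.
  rewrite exchange_big /=; apply: eq_bigr => s _.
  under eq_bigr => xs _ do rewrite mulr_sumr.
  rewrite exchange_big /=; apply: eq_bigr => t _.
  by rewrite bigA_distr_bigA; apply: eq_bigr => xs _; exact: EF.
transitivity (\sum_(s < n) \sum_x p x * z x ^+ 2); last first.
  by rewrite sumr_const card_ord mulr_natl.
apply: eq_bigr => s _; rewrite (bigD1 s) //= [X in _ + X]big1 ?addr0.
  rewrite (bigD1 s) //= [X in _ * X]big1 ?mulr1.
    by apply: eq_bigr => x _; rewrite /F eqxx -expr2.
  move=> r /negbTE rs; rewrite -[RHS]p1; apply: eq_bigr => x _.
  by rewrite /F rs !mulr1.
move=> t ts; rewrite (bigD1 s) //= [X in X * _](_ : _ = 0) ?mul0r //.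
rewrite -[RHS]z0; apply: eq_bigr => x _.
by rewrite /F eqxx eq_sym (negbTE ts) mulr1.
Qed.

Lemma tail_ge0 (T : finType) (p Z : T -> R) h delta n :
  distribution_on p -> 0 <= tail p Z h delta n.
Proof. by move=> [p0 _]; apply: sumr_ge0 => xs _; exact: prodp_ge0. Qed.

(** Chebyshev's inequality, multiplied out so that it makes sense for n = 0. *)
Lemma chebyshev_tail (T : finType) (p Z : T -> R) h delta n :
  distribution_on p -> h = \sum_x p x * Z x -> 0 < delta ->
  n%:R * delta ^+ 2 * tail p Z h delta n <= \sum_x p x * (Z x - h) ^+ 2.
Proof.
move=> [p0 p1] eh d0; have [->|n0] := posnP n.
  by rewrite !mul0r; apply: sumr_ge0 => x _; rewrite mulr_ge0 ?sqr_ge0.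
have nR : 0 < n%:R :> R by rewrite ltr0n.
rewrite -(ler_pM2l nR) -prodp_second_moment //; last first.
  under eq_bigr => x _ do rewrite mulrBr.
  by rewrite sumrB -mulr_suml p1 mul1r -eh subrr.
rewrite mulrA mulr_sumr big_mkcond /=; apply: ler_sum => xs _.
case: ifP => [hd|_]; last by rewrite mulr_ge0 ?prodp_ge0 ?sqr_ge0.
rewrite mulrC ler_wpM2l ?prodp_ge0 //.
rewrite sumrB sumr_const card_ord -[X in _ - X]mulr_natl.
rewrite mulrA -expr2 -exprMn -[leRHS]real_normK ?num_real //.
by rewrite lerXn2r // ?nnegrE ?normr_ge0 // mulr_ge0 // ltW.
Qed.

Lemma tail_cvg (T : finType) (p Z : T -> R) h delta :
  distribution_on p -> h = \sum_x p x * Z x -> 0 < delta ->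
  tail p Z h delta @ \oo --> (0 : R).
Proof.
move=> dp eh d0; apply/cvgr0Pnorm_lt => e e0.
set V := \sum_x p x * (Z x - h) ^+ 2.
near=> n.
rewrite ger0_norm ?tail_ge0 //.
have nV : V / (delta ^+ 2 * e) < n%:R by near: n; exact: nbhs_infty_gtr.
have V0 : 0 <= V by apply: sumr_ge0 => x _; rewrite mulr_ge0 ?sqr_ge0 ?dp.1.
have de : 0 < delta ^+ 2 * e by rewrite mulr_gt0 ?exprn_gt0.
have n0 : 0 < n%:R :> R by apply: le_lt_trans nV; rewrite divr_ge0 // ltW.
have nd : 0 < n%:R * delta ^+ 2 by rewrite mulr_gt0 ?exprn_gt0.
rewrite -(ltr_pM2l nd); apply: le_lt_trans (chebyshev_tail _ dp eh d0) _.
by rewrite -mulrA -ltr_pdivrMr.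
Unshelve. all: by end_near.
Qed.

End LawOfLargeNumbers.

(** * Distributed source coding *)

Section RandomBinning.
Variable R : realType.
Variables (m : nat) (X : 'I_m -> finType) (n : nat).
Local Notation Xs := {ffun 'I_n -> Xall X}.

Definition column (j : 'I_m) (xs : Xs) : {ffun 'I_n -> X j} := [ffun t => xs t j].

Lemma column_inj (xs xs' : Xs) : (forall j, column j xs = column j xs') -> xs = xs'.
Proof.
move=> h; apply/ffunP => t; apply/ffunP => j.
by have /ffunP/(_ t) := h j; rewrite !ffunE.
Qed.

Definition diffset (xs xs' : Xs) : {set 'I_m} :=
  [set j | column j xs != column j xs'].

Variable L : 'I_m -> finType.
Hypothesis L0 : forall j, (0 < #|L j|)%N.
Local Notation F := {dffun forall j, {ffun {ffun 'I_n -> X j} -> L j}}.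

(** The f j are independent, so the average factors over the players, each player of the difference
    set contributing its collision probability 1/#L_j. *)
Lemma sum_bin_collision (xs xs' : Xs) :
  \sum_(f : F) \prod_(j in diffset xs xs') (f j (column j xs) == f j (column j xs'))%:R
  = #|{: F}|%:R * \prod_(j in diffset xs xs') #|L j|%:R^-1 :> R.
Proof.
set I := diffset xs xs'.
pose P (j : 'I_m) (g : {ffun {ffun 'I_n -> X j} -> L j}) : R :=
  if j \in I then (g (column j xs) == g (column j xs'))%:R else 1.
rewrite card_dffun_prod.
under [LHS]eq_bigr => f _ do rewrite big_mkcond /=.
rewrite (sum_dffun_prod P) [X in _ = _ * X]big_mkcond -big_split /=.
apply: eq_bigr => j _; rewrite /P; case: ifP => jI; last first.
  by rewrite mulr1 -sum1_card natr_sum; apply: eq_bigl.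
have Lj : #|L j|%:R != 0 :> R by rewrite pnatr_eq0 -lt0n.
apply: (mulIf Lj); rewrite mulfVK // mulr_suml.
by apply: sum_collision; move: jI; rewrite inE.
Qed.

Variables (T : pred Xs).

(* Player j knows its own column, so only collisions of xs with a typical xs'
   sharing at least one column can make some player fail. *)
Definition bin_error (f : F) (xs : Xs) : bool :=
  ~~ T xs || [exists xs', [&& T xs', xs' != xs, [exists j, column j xs' == column j xs]
     & [forall j, f j (column j xs') == f j (column j xs)]]].

(** Union bound over the competitors, sorted by the set I of players whose columns differ. I is
    nonempty because the strings differ, and it is not everything because some column is shared:
    this is why the rate region constrains proper subsets only. *)
Lemma bin_error_le (f : F) (xs : Xs) :
  (bin_error f xs)%:R <= (~~ T xs)%:R + (T xs)%:R *
    \sum_(I : {set 'I_m} | (I != finset.set0) && (I != [set: 'I_m]%SET))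
      \sum_(xs' | T xs' && (diffset xs xs' == I))
        \prod_(j in diffset xs xs') (f j (column j xs) == f j (column j xs'))%:R :> R.
Proof.
have S0 (J : {set 'I_m}) (xs' : Xs) :
    0 <= \prod_(j in J) (f j (column j xs) == f j (column j xs'))%:R :> R.
  by apply: prodr_ge0.
rewrite /bin_error; case: (T xs) => /=; last by rewrite mul0r addr0.
rewrite add0r mul1r; case: existsP => [[xs' /and4P[Txs' ne /existsP[j0 /eqP hj0] /forallP hf]]|_] /=; last first.
  by apply: sumr_ge0 => I _; apply: sumr_ge0.
have DI : (diffset xs xs' != finset.set0) && (diffset xs xs' != [set: 'I_m]%SET).
  apply/andP; split.
    apply: contra ne => /eqP D0; apply/eqP/column_inj => j.
    apply/eqP; rewrite eq_sym; apply: contraT => h.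
    by have := finset.in_set0 j; rewrite -D0 inE h.
  apply: contraTN isT => /eqP DT.
  by have := finset.in_setT j0; rewrite -DT inE hj0 eqxx.
rewrite (bigD1 (diffset xs xs')) //= (bigD1 xs') ?Txs' ?eqxx //=.
rewrite -addrA -[leLHS]addr0 lerD //.
  by rewrite big1 // => j _; rewrite eq_sym hf.
by rewrite addr_ge0 //; [apply: sumr_ge0 | apply: sumr_ge0 => I _; apply: sumr_ge0].
Qed.

Lemma exists_good_binning (p : Xall X -> R) (N : {set 'I_m} -> R) :
  distribution_on p -> (forall I, 0 <= N I) ->
  (forall xs I, T xs -> #|[pred xs' | T xs' && (diffset xs xs' == I)]|%:R <= N I) ->
  exists f : F, \sum_(xs | bin_error f xs) prodp p xs <=
    \sum_(xs | ~~ T xs) prodp p xs +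
    \sum_(I : {set 'I_m} | (I != finset.set0) && (I != [set: 'I_m]%SET))
       N I * \prod_(j in I) #|L j|%:R^-1.
Proof.
move=> [p0 p1] N0 hN; apply: exists_le_mean.
  have hl j : exists l : L j, true by have /card_gt0P[l _] := L0 j; exists l.
  pose l0 j := projT1 (cid (hl j)).
  by apply/card_gt0P; exists [ffun j => [ffun _ => l0 j]].
rewrite mulrDr.
apply: (@le_trans _ _ (\sum_(xs : Xs) prodp p xs * \sum_(f : F) (bin_error f xs)%:R)).
  rewrite le_eqVlt; apply/orP; left; apply/eqP.
  under [RHS]eq_bigr => xs _ do rewrite mulr_sumr.
  rewrite [RHS]exchange_big /=; apply: eq_bigr => f _.
  rewrite big_mkcond /=; apply: eq_bigr => xs _.
  by case: (bin_error f xs); rewrite ?mulr1 ?mulr0.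
set S := \sum_(I | _) N I * _.
apply: (@le_trans _ _ (\sum_(xs : Xs) prodp p xs * (#|{: F}|%:R * ((~~ T xs)%:R + S)))).
  apply: ler_sum => xs _; rewrite ler_wpM2l ?prodp_ge0 //.
  apply: le_trans (ler_sum _ (fun f _ => bin_error_le f xs)) _.
  rewrite big_split /= sumr_const -[X in X + _ <= _]mulr_natl mulrDr lerD2l.
  have S0 : 0 <= S.
    apply: sumr_ge0 => I _; rewrite mulr_ge0 //.
    by apply: prodr_ge0 => j _; rewrite invr_ge0.
  rewrite -mulr_sumr; case: (boolP (T xs)) => Txs; last first.
    by rewrite mul0r mulr_ge0.
  rewrite mul1r exchange_big /= mulr_sumr; apply: ler_sum => I _.
  rewrite exchange_big /=.
  apply: (@le_trans _ _ (\sum_(xs' | T xs' && (diffset xs xs' == I))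
     #|{: F}|%:R * \prod_(j in I) #|L j|%:R^-1)).
    apply: ler_sum => xs' /andP[_ /eqP <-].
    by rewrite sum_bin_collision.
  rewrite sumr_const -[leLHS]mulr_natl mulrCA ler_wpM2l // ler_wpM2r ?hN //.
  by apply: prodr_ge0 => j _; rewrite invr_ge0.
under eq_bigr => xs _ do rewrite mulrCA mulrDr.
rewrite -mulr_sumr big_split /= -mulr_suml sum_prodp // mul1r mulrDr lerD2r.
rewrite ler_wpM2l // [leRHS]big_mkcond /=; apply: ler_sum => xs _.
by case: (T xs); rewrite ?mulr1 ?mulr0.
Qed.
End RandomBinning.

(** * Powers of two, information content and typical strings *)

Section Typicality.
Variable R : realType.

Definition pow2 (x : R) : R := expR (x * ln 2).

Lemma ln2_gt0 : 0 < ln 2 :> R. Proof. by rewrite ln_gt0 ?ltr1n. Qed.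

Lemma pow2E x : 2 `^ x = pow2 x.
Proof. by rewrite /powR pnatr_eq0. Qed.

Lemma pow2_gt0 x : 0 < pow2 x. Proof. exact: expR_gt0. Qed.

Lemma pow2_ge0 x : 0 <= pow2 x. Proof. exact: expR_ge0. Qed.

Lemma pow2D x y : pow2 (x + y) = pow2 x * pow2 y.
Proof. by rewrite /pow2 mulrDl expRD. Qed.

Lemma pow2_0 : pow2 0 = 1. Proof. by rewrite /pow2 mul0r expR0. Qed.

Lemma pow2N x : pow2 (- x) = (pow2 x)^-1.
Proof. by rewrite /pow2 mulNr expRN. Qed.

Lemma ler_pow2 x y : (pow2 x <= pow2 y) = (x <= y).
Proof. by rewrite /pow2 ler_expR ler_pM2r ?ln2_gt0. Qed.

Lemma pow2_sum (I : finType) (P : pred I) (F : I -> R) :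
  pow2 (\sum_(i | P i) F i) = \prod_(i | P i) pow2 (F i).
Proof. exact: (big_morph pow2 pow2D pow2_0). Qed.

Lemma pow2_log2 x : 0 < x -> pow2 (log2 x) = x.
Proof. by move=> x0; rewrite /pow2 /log2 divfK ?lnK // gt_eqF ?ln2_gt0. Qed.

Lemma log2_pow2 x : log2 (pow2 x) = x.
Proof. by rewrite /pow2 /log2 expRK mulfK // gt_eqF ?ln2_gt0. Qed.

Definition info (T : Type) (q : T -> R) (x : T) : R := - log2 (q x).

Lemma prodp_pow2 (T : finType) (q : T -> R) n (xs : {ffun 'I_n -> T}) :
  (forall t, 0 < q (xs t)) -> prodp q xs = pow2 (- \sum_t info q (xs t)).
Proof.
move=> q0; rewrite -sumrN pow2_sum; apply: eq_bigr => t _.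
by rewrite /info opprK pow2_log2.
Qed.

Lemma prodp_typical (T : finType) (q : T -> R) h delta n (xs : {ffun 'I_n -> T}) :
  (forall t, 0 < q (xs t)) -> ~~ deviates (info q) h delta xs ->
  pow2 (- (n%:R * (h + delta))) <= prodp q xs <= pow2 (- (n%:R * (h - delta))).
Proof.
move=> q0; rewrite /deviates -ltNge prodp_pow2 // !ler_pow2 => hd.
have := ltW hd; rewrite ler_norml => /andP[h1 h2].
rewrite !mulrDr mulrN.
by apply/andP; split; lra.
Qed.

Lemma eta_info (T : Type) (q : T -> R) x : q x * info q x = Defs.eta (q x).
Proof. by rewrite /info /Defs.eta; case: eqP => [->|_]; rewrite ?mul0r // mulrN. Qed.

Lemma sum_eta_info (T : finType) (q : T -> R) :
  \sum_x Defs.eta (q x) = \sum_x q x * info q x.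
Proof. by apply: eq_bigr => x _; rewrite eta_info. Qed.

(** The marginal of r, pulled back to X: all marginals then live on the same alphabet, and
    typicality for each of them is a condition on one string. *)
Definition fibre_sum (X Z : finType) (r : X -> Z) (p : X -> R) (x : X) : R :=
  \sum_(x' | r x' == r x) p x'.

Lemma shannon_fibre (X Z : finType) (r : X -> Z) (p : X -> R) :
  shannon (fun z => \sum_(x | r x == z) p x) = \sum_x p x * info (fibre_sum r p) x.
Proof.
rewrite [RHS](partition_big r xpredT) //=; apply: eq_bigr => z _.
rewrite -(eta_info (fun z => \sum_(x | r x == z) p x)) mulr_suml.
by apply: eq_bigr => x /eqP rx; rewrite /info /fibre_sum rx.
Qed.

Lemma prodp_fibre_sum (X Z : finType) (r : X -> Z) (p : X -> R) n (xs : {ffun 'I_n -> X}) :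
  prodp (fibre_sum r p) xs = \sum_(xs' : {ffun 'I_n -> X} | [forall t, r (xs' t) == r (xs t)]) prodp p xs'.
Proof.
rewrite /prodp /fibre_sum.
rewrite (bigA_distr_big_dep (fun t x => r x == r (xs t)) (fun _ => p)).
by apply: eq_bigl => xs'; apply/familyP/forallP.
Qed.

End Typicality.

(** * Joint typicality and the rate region *)

Section SlepianWolf.
Variable R : realType.
Variables (m : nat) (X : 'I_m -> finType) (p : Xall X -> R).
Hypothesis dp : distribution_on p.

Definition marginal (J : {set 'I_m}) : Xall X -> R := fibre_sum (restr (X := X) J) p.

(** The entropy H(X_J), written as the mean of an information content so that the law of large
    numbers applies to it directly. *)
Definition marginal_entropy (J : {set 'I_m}) : R := \sum_x p x * info (marginal J) x.

Lemma restr_setT_inj : injective (restr (X := X) [set: 'I_m]%SET).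
Proof.
move=> x x' /ffunP h; apply/ffunP => j.
by have := h j; rewrite !ffunE finset.in_setT => -[].
Qed.

Lemma marginal_setT : marginal [set: 'I_m]%SET = p.
Proof.
apply/funext => x; rewrite /marginal /fibre_sum.
under eq_bigl => x' do rewrite (inj_eq restr_setT_inj).
by rewrite big_pred1_eq.
Qed.

Lemma marginal_ge J x : p x <= marginal J x.
Proof.
rewrite /marginal /fibre_sum (bigD1 x) //= lerDl.
by apply: sumr_ge0 => x' _; exact: dp.1.
Qed.

(** A marginal probability dominates the joint one pointwise. The use is nonnegativity of
    conditional entropies, hence of the message rates. *)
Lemma marginal_entropy_le J : marginal_entropy J <= marginal_entropy [set: 'I_m]%SET.
Proof.
apply: ler_sum => x _; have [p0 p1] := dp.
have [->|px] := eqVneq (p x) 0; first by rewrite !mul0r.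
have px0 : 0 < p x by rewrite lt_def px p0.
rewrite ler_pM2l // /info lerN2 ler_pM2r ?invr_gt0 ?ln2_gt0 //.
have mJ := marginal_ge J x; have mJ0 := lt_le_trans px0 mJ.
by rewrite marginal_setT ler_ln ?posrE.
Qed.

Variable delta : R.
Hypothesis d0 : 0 < delta.

(* As log2 0 = 0, positivity of the probabilities has to be required separately. *)
Definition typical n (xs : {ffun 'I_n -> Xall X}) : bool :=
  [forall t, 0 < p (xs t)] &&
  [forall J : {set 'I_m}, ~~ deviates (info (marginal J)) (marginal_entropy J) delta xs].

Definition atypical_mass n : R :=
  \sum_(J : {set 'I_m}) tail p (info (marginal J)) (marginal_entropy J) delta n.

Lemma atypical_le n : \sum_(xs : {ffun 'I_n -> Xall X} | ~~ typical xs) prodp p xs <= atypical_mass n.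
Proof.
have [p0 p1] := dp.
rewrite /atypical_mass /tail (exchange_big_dep xpredT) //= big_mkcond /=.
apply: ler_sum => xs _.
have S0 : 0 <= \sum_(J : {set 'I_m} | deviates (info (marginal J)) (marginal_entropy J) delta xs) prodp p xs.
  by apply: sumr_ge0 => J _; exact: prodp_ge0.
case: ifP => // /nandP[/forallPn[t]|/forallPn[J]].
  rewrite -leNgt => pt; suff e : prodp p xs = 0 by rewrite {1}e.
  apply/eqP/prodf_eq0; exists t => //; apply/eqP/le_anti.
  by rewrite pt p0.
rewrite negbK => hJ; rewrite (bigD1 J) //= lerDl.
by apply: sumr_ge0 => J' _; exact: prodp_ge0.
Qed.

(** All counted strings agree with xs outside I, so their total probability is at most the marginal
    probability of that part of xs, about 2^(-n H(~: I)). Each of them has probability at least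
    about 2^(-n H). The quotient bounds their number, with one delta lost on each side. *)
Lemma card_typical_le n (xs : {ffun 'I_n -> Xall X}) (I : {set 'I_m}) :
  typical xs ->
  #|[pred xs' | typical xs' && (diffset xs xs' == I)]|%:R <=
  pow2 (n%:R * (marginal_entropy [set: 'I_m]%SET - marginal_entropy (~: I)%SET + 2 * delta)).
Proof.
move=> /andP[/forallP hp /forallP hd].
set HT := marginal_entropy _; set HI := marginal_entropy _.
have [p0 p1] := dp.
have /andP[_ up] := prodp_typical (q := marginal (~: I)%SET)
   (fun t => lt_le_trans (hp t) (marginal_ge _ _)) (hd (~: I)%SET).
have -> : n%:R * (HT - HI + 2 * delta) = n%:R * (HT + delta) - (n%:R * (HI - delta)) by ring.
rewrite pow2D -ler_pdivrMl ?pow2_gt0 // -pow2N.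
apply: le_trans up; rewrite prodp_fibre_sum.
rewrite -sum1_card natr_sum mulr_sumr big_mkcond [leRHS]big_mkcond /=.
apply: ler_sum => xs' _; rewrite mulr1; case: ifP => [/andP[/andP[/forallP hp' /forallP hd'] /eqP DI]|_].
  have /andP[lo _] := prodp_typical (q := marginal [set: 'I_m]%SET)
    (fun t => lt_le_trans (hp' t) (marginal_ge _ _)) (hd' [set: 'I_m]%SET).
  rewrite marginal_setT in lo.
  case: ifP => // /negP[]; apply/forallP => t; apply/eqP/ffunP => j.
  rewrite !ffunE -DI !inE negbK; case: eqP => // /ffunP/(_ t).
  by rewrite !ffunE => ->.
by case: ifP => // _; exact: prodp_ge0.
Qed.

Variable Rt : 'I_m -> R.
Hypothesis hRt : forall I : {set 'I_m}, I \proper [set: 'I_m]%SET ->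
  marginal_entropy [set: 'I_m]%SET - marginal_entropy (~: I)%SET <= \sum_(j in I) Rt j.

(** One term for each set I; 2^m collects the factors 2 lost by rounding the alphabet sizes. *)
Definition sw_bound n : R :=
  atypical_mass n + #|{set 'I_m}|%:R * (2 ^+ m * pow2 (- (n%:R * delta))).

Lemma slepian_wolf n (L : 'I_m -> finType) :
  (forall j, pow2 (n%:R * (Rt j + 3 * delta)) <= 2 * #|L j|%:R) ->
  exists f : {dffun forall j, {ffun {ffun 'I_n -> X j} -> L j}},
    \sum_(xs | bin_error (@typical n) f xs) prodp p xs <= sw_bound n.
Proof.
move=> hL.
have L0 j : (0 < #|L j|)%N.
  by rewrite -(ltr0n R) -(pmulr_rgt0 _ (ltr0n R 2)); apply: lt_le_trans (hL j); exact: pow2_gt0.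
pose N (I : {set 'I_m}) := pow2 (n%:R * (marginal_entropy [set: 'I_m]%SET - marginal_entropy (~: I)%SET + 2 * delta)).
have [f hf] := exists_good_binning L0 dp (fun I => pow2_ge0 _ : 0 <= N I) (@card_typical_le n).
exists f; apply: le_trans hf _; apply: lerD; first exact: atypical_le.
apply: (@le_trans _ _ (\sum_(I : {set 'I_m}) 2 ^+ m * pow2 (- (n%:R * delta)))); last first.
  by rewrite sumr_const -[leLHS]mulr_natl.
rewrite big_mkcond /=; apply: ler_sum => I _; case: ifP => [/andP[I0 IT]|_]; last first.
  by rewrite mulr_ge0 ?exprn_ge0 ?pow2_ge0.
have nz : 0 <= n%:R :> R by [].
apply: (@le_trans _ _ (N I * \prod_(j in I) (2 * pow2 (- (n%:R * (Rt j + 3 * delta)))))).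
  rewrite ler_wpM2l ?pow2_ge0 //; apply: ler_prod => j _.
  rewrite invr_ge0 ler0n /= pow2N ler_pdivlMr ?pow2_gt0 // ler_pdivrMl ?ltr0n ?L0 //.
  by rewrite [leRHS]mulrC.
rewrite big_split /= prodr_const mulrCA -pow2_sum -pow2D; apply: ler_pM.
- by rewrite exprn_ge0.
- exact: pow2_ge0.
- by rewrite ler_weXn2l ?ler1n // -[leqRHS]card_ord max_card.
rewrite ler_pow2 sumrN -mulr_sumr big_split /= sumr_const -[_ *+ #|I|]mulr_natr.
(* Counting costs 2 delta and the rates offer 3 delta #|I|; as I is nonempty, at least delta is
   left. *)
have hI : 1 <= #|I|%:R :> R by rewrite ler1n card_gt0.
have := hRt (I := I); rewrite finset.properEneq IT finset.subsetT => /(_ isT) hR.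
rewrite -subr_ge0.
set S := \sum_(j in I) Rt j in hR *; set a := marginal_entropy _ - _ in hR *.
have -> : - (n%:R * delta) - (n%:R * (a + 2 * delta) - n%:R * (S + 3 * delta * #|I|%:R)) =
   n%:R * ((S - a) + 3 * delta * (#|I|%:R - 1)) by ring.
by rewrite mulr_ge0 // addr_ge0 ?subr_ge0 // mulr_ge0 ?subr_ge0 // mulr_ge0 // ltW.
Qed.

Local Open Scope classical_set_scope.

Lemma pow2_cvg0 (a : R) : 0 < a -> (fun n : nat => pow2 (- (n%:R * a))) @ \oo --> (0 : R).
Proof.
move=> a0.
have -> : (fun n : nat => pow2 (- (n%:R * a))) = (fun n => (pow2 (- a)) ^+ n).
  by apply/funext => n; rewrite /pow2 -expRM_natl; congr expR; ring.
apply: cvg_expr; rewrite ger0_norm ?pow2_ge0 //.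
by rewrite /pow2 expR_lt1 mulNr oppr_lt0 mulr_gt0 ?ln2_gt0.
Qed.

Lemma sw_bound_cvg : sw_bound @ \oo --> (0 : R).
Proof.
have h1 : atypical_mass @ \oo --> (0 : R).
  have -> : (0 : R) = \sum_(J : {set 'I_m}) 0 by rewrite big1.
  apply: (@cvg_big R _ +%R 0 (fun=> true)) => [|J _]; first exact: add_continuous.
  by apply: tail_cvg => //; exact: dp.
have h2 : (fun n : nat => #|{set 'I_m}|%:R * (2 ^+ m * pow2 (- (n%:R * delta)))) @ \oo --> (0 : R).
  rewrite -(mulr0 (#|{set 'I_m}|%:R)) -[X in _ * X](mulr0 (2 ^+ m)).
  by apply: cvgMr; apply: cvgMr; exact: pow2_cvg0.
by have := cvgD h1 h2; rewrite addr0; apply.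
Qed.

End SlepianWolf.

(** * Secrecy of the hashed key for n copies *)

Section TensorPower.
Variable R : realType.
Local Notation C := (R[i]).

Lemma prod_bool (K : comNzRingType) (I : finType) (b : pred I) :
  \prod_i (b i)%:R = [forall i, b i]%:R :> K.
Proof.
case: (boolP [forall i, b i]) => [/forallP h|/forallPn[i hi]].
  by rewrite big1 // => i _; rewrite h.
by rewrite (bigD1 i) //= (negbTE hi) mul0r.
Qed.

Lemma ffun_eqb (I : finType) (S : eqType) (y z : {ffun I -> S}) :
  [forall t, y t == z t] = (y == z).
Proof.
by apply/forallP/eqP => [h|-> //]; apply/ffunP => t; apply/eqP.
Qed.

Definition tpow (S E : finType) (v : S -> E -> C) n
    (y : {ffun 'I_n -> S}) : {ffun 'I_n -> E} -> C :=
  fun e => \prod_t v (y t) (e t).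

Lemma inner_tpow (S S' E : finType) (v : S -> E -> C) (w : S' -> E -> C) n
    (y : {ffun 'I_n -> S}) (z : {ffun 'I_n -> S'}) :
  inner (tpow v y) (tpow w z) = \prod_t inner (v (y t)) (w (z t)).
Proof.
rewrite /inner /tpow.
rewrite (bigA_distr_bigA (fun t e => Num.conj (v (y t) e) * w (z t) e)).
by apply: eq_bigr => e _; rewrite rmorph_prod -big_split.
Qed.

Lemma norm2_tpow (S E : finType) (v : S -> E -> C) n (y : {ffun 'I_n -> S}) :
  (forall s, norm2 (v s) = 1) -> norm2 (tpow v y) = 1.
Proof.
move=> v1; apply: complexI; rewrite norm2E inner_tpow big1 // => t _.
by rewrite -norm2E v1.
Qed.

Lemma orthobasis_tpow (J E : finType) (e : J -> E -> C) n :
  orthobasis e -> orthobasis (tpow e (n := n)).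
Proof.
move=> [ho hc]; split=> [s t|i k].
  rewrite inner_tpow -ffun_eqb -prod_bool; apply: eq_bigr => r _; exact: ho.
rewrite /tpow; under eq_bigr => t _ do rewrite rmorph_prod -big_split /=.
rewrite -(bigA_distr_bigA (fun r t => e t (i r) * Num.conj (e t (k r)))).
by rewrite -ffun_eqb -prod_bool; apply: eq_bigr => r _; exact: hc.
Qed.

Lemma cabs_prod (I : finType) (F : I -> C) : cabs (\prod_i F i) = \prod_i cabs (F i).
Proof.
have c1 : cabs (1 : C) = 1 by apply: complexI; rewrite cabsE normr1.
exact: (big_morph _ (@cabsM R) c1).
Qed.

Section IID.
Variables (E Y X J : finType) (w : Y -> R) (v : Y -> E -> C) (p : Y -> X).
Variables (e : J -> E -> C) (mu : J -> R) (SXE SE delta : R).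
Hypothesis dw : distribution_on w.
Hypothesis dmu : distribution_on mu.
Hypothesis v1 : forall y, norm2 (v y) = 1.
Hypothesis be : orthobasis e.
Hypothesis vo : forall y y', p y = p y' -> y != y' -> inner (v y) (v y') = 0.
Hypothesis wmu : forall j, \sum_y w y * cabs (inner (e j) (v y)) ^+ 2 = mu j.
Hypothesis eSXE : SXE = \sum_y Defs.eta (w y).
Hypothesis eSE : SE = \sum_j Defs.eta (mu j).
Hypothesis d0 : 0 < delta.

Definition typical_for (S : finType) (q : S -> R) (h : R) n (y : {ffun 'I_n -> S}) : bool :=
  [forall t, 0 < q (y t)] && ~~ deviates (info q) h delta y.

Lemma atypical_for_le (S : finType) (q : S -> R) h n : distribution_on q ->
  \sum_(y : {ffun 'I_n -> S} | ~~ typical_for q h y) prodp q y <= tail q (info q) h delta n.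
Proof.
move=> [q0 q1]; rewrite /tail big_mkcond [leRHS]big_mkcond /=; apply: ler_sum => y _.
have P0 := prodp_ge0 y q0.
case: ifP => [/nandP[/forallPn[t]|]|_]; last by case: ifP.
  rewrite -leNgt => qt; suff e0 : prodp q y = 0 by rewrite {1}e0; case: ifP.
  by apply/eqP/prodf_eq0; exists t => //; apply/eqP/le_anti; rewrite qt q0.
by rewrite negbK => ->.
Qed.

Definition iid_project n (y : {ffun 'I_n -> Y}) : {ffun 'I_n -> X} := [ffun t => p (y t)].

Definition secrecy_bound n : R :=
  2 * (tail w (info w) SXE delta n + Num.sqrt (tail mu (info mu) SE delta n)).

(** g is quantified before W, because W will be the sign of an operator built from g. The exponent
    combines at most 2^(n(SE + delta)) typical e j with a sum of squared typical weights of at most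
    2^(-n(SXE - delta)). *)
Lemma iid_privacy n (K L : finType) (f : {ffun 'I_n -> X} -> L) : (0 < #|K|)%N ->
  exists g : {ffun {ffun 'I_n -> X} -> K},
  forall W : K * L -> op R {ffun 'I_n -> E}, (forall b, op_contraction (W b)) ->
  cabs (\sum_b \sum_(y : {ffun 'I_n -> Y})
      (hash_coef R f g b (iid_project y) * prodp w y)%:C
        * inner (tpow v y) (apply_op (W b) (tpow v y)))
  <= secrecy_bound n
     + Num.sqrt (#|K|%:R * #|L|%:R * pow2 (n%:R * (SE - SXE + 2 * delta))).
Proof.
move=> K0.
have [w0 w1] := dw; have [mu0 mu1] := dmu.
pose H (y : {ffun 'I_n -> Y}) := typical_for w SXE y.
pose G (j : {ffun 'I_n -> J}) := typical_for mu SE j.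
have vv1 (y : {ffun 'I_n -> Y}) : norm2 (tpow v y) = 1 by exact: norm2_tpow.
have vvo (y y' : {ffun 'I_n -> Y}) : iid_project y = iid_project y' -> y != y' ->
    inner (tpow v y) (tpow v y') = 0.
  move=> pp; rewrite -ffun_eqb => /forallPn[t yt].
  rewrite inner_tpow (bigD1 t) //= vo ?mul0r //.
  by move/ffunP: pp => /(_ t); rewrite !ffunE.
have [g hg] := @exists_good_hash R _ _ _ L K (@prodp R Y w n) (tpow v (n := n)) _ H f K0 vv1 vvo.
exists g => W cW.
have := @privacy_split R _ _ _ _ _ (@prodp R Y w n) (tpow v (n := n)) (@iid_project n) (tpow e (n := n)) G H
  (hash_coef R f g) W 2 (fun y => prodp_ge0 y w0) (sum_prodp n w1) vv1
  (orthobasis_tpow n be) cW (fun x => sum_norm_hash_coef R f g x K0).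
move=> /le_trans; apply; apply: lerD.
  rewrite ler_wpM2l // lerD //; first exact: atypical_for_le.
  (* Averaged over y, the squared overlap of [tpow v y] with basis vector j is the product weight of
     j under mu, so the mean loss of the projection is the atypical mass of mu. *)
  rewrite ler_wsqrtr //; apply: le_trans (atypical_for_le SE n dmu).
  under eq_bigr => y _ do rewrite mulr_sumr.
  rewrite exchange_big /=; apply: ler_sum => j _.
  rewrite le_eqVlt; apply/orP; left; apply/eqP.
  transitivity (\prod_t \sum_y w y * cabs (inner (e (j t)) (v y)) ^+ 2); last first.
    by apply: eq_bigr => t _; exact: wmu.
  rewrite (bigA_distr_bigA (fun t y => w y * cabs (inner (e (j t)) (v y)) ^+ 2)).
  apply: eq_bigr => y _; rewrite big_split /=; congr (_ * _).
  by rewrite inner_tpow cabs_prod -prodrXl.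
have cG : #|G|%:R <= pow2 (n%:R * (SE + delta)).
  rewrite -(ler_pM2r (pow2_gt0 (- (n%:R * (SE + delta))))) -pow2D subrr pow2_0.
  rewrite -[leRHS](sum_prodp n mu1).
  rewrite [leLHS]mulr_natl -[leLHS]sumr_const [leLHS]big_mkcond /=; apply: ler_sum => j _; rewrite unfold_in.
  case: ifP => [/andP[/forallP hj hd]|_]; last exact: prodp_ge0.
  by case/andP: (prodp_typical hj hd).
have hH : \sum_(y | H y) prodp w y ^+ 2 <= pow2 (- (n%:R * (SXE - delta))).
  rewrite -[leRHS]mulr1 -[X in _ <= _ * X](sum_prodp n w1) mulr_sumr big_mkcond /=.
  apply: ler_sum => y _; case: ifP => [/andP[/forallP hy hd]|_].
    rewrite expr2 ler_wpM2r ?prodp_ge0 //.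
    by case/andP: (prodp_typical hy hd).
  by rewrite mulr_ge0 ?pow2_ge0 ?prodp_ge0.
rewrite ler_wsqrtr // card_prod natrM.
have -> : n%:R * (SE - SXE + 2 * delta) = n%:R * (SE + delta) + - (n%:R * (SXE - delta)).
  by ring.
rewrite pow2D [leRHS]mulrA.
apply: le_trans (_ : _ <= #|K|%:R * #|L|%:R * #|G|%:R * pow2 (- (n%:R * (SXE - delta)))) _.
  by rewrite ler_wpM2l ?mulr_ge0 //; exact: le_trans hg hH.
by rewrite ler_wpM2r ?pow2_ge0 // ler_wpM2l ?mulr_ge0.
Qed.

Local Open Scope classical_set_scope.

Lemma secrecy_bound_cvg : secrecy_bound @ \oo --> (0 : R).
Proof.
have h1 : tail w (info w) SXE delta @ \oo --> (0 : R).
  by apply: tail_cvg => //; rewrite eSXE sum_eta_info.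
have h2 : tail mu (info mu) SE delta @ \oo --> (0 : R).
  by apply: tail_cvg => //; rewrite eSE sum_eta_info.
have h3 : (fun n => Num.sqrt (tail mu (info mu) SE delta n)) @ \oo --> (0 : R).
  rewrite -(sqrtr0 R); apply: (continuous_cvg _ _ h2); exact: sqrt_continuous.
have -> : (0 : R) = 2 * (0 + 0) by rewrite addr0 mulr0.
by apply: cvgMr; exact: cvgD.
Qed.

End IID.

End TensorPower.

(** * The measure-and-hash protocol *)

Section OperatorIdentities.
Variable R : realType.
Local Notation C := (R[i]).

Lemma ptrace1_mul_id (A E : finType) (F : op R (A * E)%type) (D : op R A) e e' :
  ptrace1 (opmul F (optensor D (opid R (T:=E)))) e e' =
  \sum_a \sum_a' F (a, e) (a', e') * D a' a.
Proof.
rewrite /ptrace1 /opmul /optensor /opid; apply: eq_bigr => a _.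
rewrite sum_pair; apply: eq_bigr => a' _ /=.
under eq_bigr => e1 _ do rewrite mulrA.
exact: sum_delta_r.
Qed.

Lemma lapply_id_tensor (K S T : finType) (F : lmap R S T) (A : op R (K * S)%type) a a' t t' :
  lapply (lmap_tensor (@lmap_id R K) F) A (a, t) (a', t') =
  \sum_s \sum_s' A (a, s) (a', s') * F s s' t t'.
Proof.
rewrite /lapply /lmap_tensor /lmap_id /= sum_pair.
transitivity (\sum_c (c == a)%:R * \sum_s \sum_s' A (c, s) (a', s') * F s s' t t').
  apply: eq_bigr => c _; rewrite mulr_sumr; apply: eq_bigr => s _.
  rewrite sum_pair /=.
  transitivity (\sum_c' (c' == a')%:R * ((c == a)%:R * \sum_s' A (c, s) (c', s') * F s s' t t')).
    apply: eq_bigr => c' _; rewrite !mulr_sumr; apply: eq_bigr => s' _.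
    by rewrite -mulnb natrM (eq_sym a) (eq_sym a'); ring.
  by rewrite sum_delta.
by rewrite sum_delta.
Qed.

Lemma lapply_tensor_id (K S T : finType) (F : lmap R S T) (A : op R (S * K)%type) a a' t t' :
  lapply (lmap_tensor F (@lmap_id R K)) A (t, a) (t', a') =
  \sum_s \sum_s' A (s, a) (s', a') * F s s' t t'.
Proof.
rewrite /lapply /lmap_tensor /lmap_id /= sum_pair; apply: eq_bigr => s _.
transitivity (\sum_c (c == a)%:R * \sum_s' A (s, c) (s', a') * F s s' t t').
  apply: eq_bigr => c _; rewrite sum_pair mulr_sumr; apply: eq_bigr => s' _ /=.
  transitivity (\sum_c' (c' == a')%:R * ((c == a)%:R * (A (s, c) (s', c') * F s s' t t'))).
    apply: eq_bigr => c' _.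
    by rewrite -mulnb natrM (eq_sym a) (eq_sym a'); ring.
  by rewrite sum_delta.
by rewrite sum_delta.
Qed.

End OperatorIdentities.

Section ClassicalProtocol.
Variable R : realType.
Local Notation C := (R[i]).
Variables (m : nat) (d : 'I_m -> nat) (dE : nat) (X : 'I_m -> finType).
Variables (rho : op R (sysAE d dE)) (M : forall j : 'I_m, X j -> op R 'I_(d j)).
Hypothesis hM : forall j, is_povm (@M j).
Variables (n : nat) (K : finType) (L : 'I_m -> finType).
Local Notation Xn j := {ffun 'I_n -> X j}.
Local Notation Lt := {dffun forall i, L i}.
Variables (f : forall j, Xn j -> L j) (dec : forall j, Xn j -> Lt -> K).

(* The register A'_j stores x_j^n, encoded as an ordinal through enum_val. *)
Definition measure_inst (j : 'I_m) (l : L j) : lmap R {ffun 'I_n -> 'I_(d j)} 'I_#|{: Xn j}| :=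
  fun s s' t t' => ((t == t') && (f (enum_val t) == l))%:R
     * \prod_r M (enum_val t r) (s' r) (s r).

Definition classical_dec (j : 'I_m) (l : Lt) (k : K) : op R 'I_#|{: Xn j}| :=
  fun t t' => ((t == t') && (dec (enum_val t) l == k))%:R.

Definition classical_protocol : protocol R d n :=
  @Protocol R m d n K L (fun j => #|{: Xn j}|) measure_inst classical_dec.

(** The output is diagonal in the stored outcome t, and each diagonal entry is a partial trace
    against a tensor product of POVM elements, positive by [psd_ptrace_mul]. *)
Lemma measure_inst_cp j l : is_cp (measure_inst (j := j) l).
Proof.
move=> k A pA v.
pose Q (t : 'I_#|{: Xn j}|) (a a' : 'I_k) : C := \sum_s \sum_s' A (a, s) (a', s') * \prod_r M (enum_val t r) (s' r) (s r).
have pQ (t : 'I_#|{: Xn j}|) : psd (Q t).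
  apply: psd_ptrace_mul pA (factored_tpow (A := fun r => M (enum_val t r)) _) => r.
  exact: (hM j).1.
suff -> : \sum_i \sum_i' Num.conj (v i) * lapply (lmap_tensor (@lmap_id R 'I_k) (measure_inst l)) A i i' * v i' =
   \sum_t (f (enum_val t) == l)%:R * \sum_a \sum_a' Num.conj (v (a, t)) * Q t a a' * v (a', t).
  by apply: sumr_ge0 => t _; apply: mulr_ge0 => //; exact: pQ.
rewrite sum_pair exchange_big /=; apply: eq_bigr => t _.
rewrite mulr_sumr; apply: eq_bigr => a _.
rewrite sum_pair mulr_sumr; apply: eq_bigr => a' _.
transitivity (\sum_t' (t' == t)%:R * ((f (enum_val t) == l)%:R * (Num.conj (v (a, t)) * Q t a a' * v (a', t')))).
  apply: eq_bigr => t' _; rewrite lapply_id_tensor.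
  have -> : \sum_s \sum_s' A (a, s) (a', s') * measure_inst l s s' t t' =
     ((t == t') && (f (enum_val t) == l))%:R * Q t a a'.
    rewrite /Q mulr_sumr; apply: eq_bigr => s _.
    by rewrite mulr_sumr; apply: eq_bigr => s' _; rewrite /measure_inst mulrCA.
  by rewrite -mulnb natrM (eq_sym t); ring.
by rewrite sum_delta.
Qed.

Lemma measure_inst_tp j : is_tp (lmap_sum (measure_inst (j := j))).
Proof.
move=> A; rewrite /optrace /lapply /lmap_sum.
transitivity (\sum_s \sum_s' A s s' * \sum_(x : Xn j) \prod_r M (x r) (s' r) (s r)).
  rewrite exchange_big /=; apply: eq_bigr => s _.
  rewrite exchange_big /=; apply: eq_bigr => s' _.
  rewrite [in RHS](reindex (@enum_val _ (mem {: Xn j}))) /=; last exact/onW_bij/enum_val_bij.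
  rewrite mulr_sumr; apply: eq_bigr => t _; congr (_ * _).
  rewrite /measure_inst -mulr_suml eqxx /=.
  by rewrite (bigD1 (f (enum_val t))) //= eqxx big1 ?addr0 ?mul1r // => l /negbTE; rewrite eq_sym => ->.
apply: eq_bigr => s _.
transitivity (\sum_s' A s s' * (s' == s)%:R); last by rewrite sum_delta_r.
apply: eq_bigr => s' _; congr (_ * _).
rewrite -(bigA_distr_bigA (fun r x => M x (s' r) (s r))) -ffun_eqb -prod_bool.
by apply: eq_bigr => r _; exact: (hM j).2.
Qed.

Lemma classical_dec_povm j l : is_povm (classical_dec (j := j) l).
Proof.
split=> [k v|t t']; last first.
  rewrite /classical_dec /opid; case: (t == t') => /=; last by rewrite big1.
  by rewrite (bigD1 (dec (enum_val t) l)) //= eqxx big1 ?addr0 // => k /negbTE; rewrite eq_sym => ->.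
apply: sumr_ge0 => t _; rewrite (bigD1 t) //= big1 ?addr0.
  by rewrite /classical_dec eqxx mulrAC mulr_ge0 // mulrC mul_conjC_ge0.
by move=> t' /negbTE; rewrite eq_sym /classical_dec => ->; rewrite mulr0 mul0r.
Qed.

Lemma classical_protocol_valid : valid_protocol classical_protocol.
Proof.
split=> [j|j l]; last exact: classical_dec_povm.
by split=> [l|]; [exact: measure_inst_cp | exact: measure_inst_tp].
Qed.

Definition cq_pow (xs : {ffun 'I_n -> Xall X}) : op R {ffun 'I_n -> 'I_dE} :=
  fun e e' => \prod_r cq_block rho (@M) (xs r) (e r) (e' r).

(** [rho_n] is indexed player by player while the state is a product copy by copy; [tr] and [rt]
    transpose the two indices, after which the sum factors over the copies. *)
Lemma measure_rho_n (xs : {ffun 'I_n -> Xall X}) e e' :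
  \sum_(s : sysAn d n) \sum_(s' : sysAn d n) rho_n rho (s, e) (s', e') *
     \prod_j \prod_r M (xs r j) (s' j r) (s j r) = cq_pow xs e e'.
Proof.
pose tr (s : {ffun 'I_n -> sysA d}) : sysAn d n := [ffun j => [ffun r => s r j]].
pose rt (s : sysAn d n) : {ffun 'I_n -> sysA d} := [ffun r => [ffun j => s j r]].
have trK : cancel tr rt by move=> s; apply/ffunP => r; apply/ffunP => j; rewrite !ffunE.
have rtK : cancel rt tr by move=> s; apply/ffunP => r; apply/ffunP => j; rewrite !ffunE.
have trB : bijective tr by exists rt.
rewrite (reindex tr) /=; last exact: onW_bij.
transitivity (\sum_(s : {ffun 'I_n -> sysA d}) \sum_(s' : {ffun 'I_n -> sysA d})
   \prod_r (rho (s r, e r) (s' r, e' r) * \prod_j M (xs r j) (s' r j) (s r j))).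
  apply: eq_bigr => s _; rewrite (reindex tr) /=; last exact: onW_bij.
  apply: eq_bigr => s' _; rewrite big_split /=; congr (_ * _).
    apply: eq_bigr => r _; rewrite !ffunE /=.
    by congr (rho (_, _) (_, _)); apply/ffunP => j; rewrite !ffunE.
  rewrite exchange_big /=; apply: eq_bigr => r _; apply: eq_bigr => j _.
  by rewrite !ffunE.
transitivity (\prod_r \sum_a \sum_a' rho (a, e r) (a', e' r) * \prod_j M (xs r j) (a' j) (a j)).
  rewrite bigA_distr_bigA; apply: eq_bigr => s _.
  by rewrite bigA_distr_bigA.
by apply: eq_bigr => r _; rewrite /cq_block ptrace1_mul_id.
Qed.

(** The decoders are diagonal, so only diagonal register contents survive, and these correspond
    bijectively to the strings xs through their columns. *)
Lemma out_blockE k l e e' :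
  out_block (P := classical_protocol) rho k l e e' =
  \sum_(xs : {ffun 'I_n -> Xall X})
    ([forall j, dec (column j xs) l == k j] && [forall j, f (column j xs) == l j])%:R
    * cq_pow xs e e'.
Proof.
rewrite /out_block ptrace1_mul_id.
pose tr (xs : {ffun 'I_n -> Xall X}) : {dffun forall j, 'I_#|{: Xn j}|} :=
  [ffun j => enum_rank (column j xs)].
pose rt (t : {dffun forall j, 'I_#|{: Xn j}|}) : {ffun 'I_n -> Xall X} :=
  [ffun r => [ffun j => enum_val (t j) r]].
have trK : cancel tr rt.
  by move=> s; apply/ffunP => r; apply/ffunP => j; rewrite !ffunE enum_rankK !ffunE.
have rtK : cancel rt tr.
  move=> t; apply/ffunP => j; rewrite !ffunE; apply: (canLR enum_valK).
  by apply/ffunP => r; rewrite !ffunE.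
rewrite (reindex tr) /=; last by apply/onW_bij; exists rt.
apply: eq_bigr => xs _.
rewrite (bigD1 (tr xs)) //= [X in _ + X]big1 ?addr0; last first.
  move=> t' ht'; rewrite /optensorn /classical_dec.
  have /forallPn[j hj] : ~~ [forall j, t' j == tr xs j].
    apply: contra ht' => /forallP h; apply/eqP/ffunP => j; exact/eqP/h.
  by rewrite (bigD1 j) //= (negbTE hj) mul0r mulr0.
rewrite lapply_tensor_id /optensorn /classical_dec.
under [X in _ * X]eq_bigr => j _ do rewrite eqxx ffunE enum_rankK /=.
rewrite prod_bool -measure_rho_n -mulnb natrM -mulrA mulrC; congr (_ * _).
rewrite mulr_sumr; apply: eq_bigr => s _; rewrite mulr_sumr; apply: eq_bigr => s' _.
rewrite [RHS]mulrCA; congr (_ * _).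
rewrite /lmap_tensorn /measure_inst big_split /= -prod_bool.
congr (_ * _); apply: eq_bigr => j _; first by rewrite eqxx ffunE enum_rankK.
by apply: eq_bigr => r _; rewrite ffunE enum_rankK ffunE.
Qed.

End ClassicalProtocol.

(** * Spectral data of one copy *)

Section SingleLetter.
Variable R : realType.
Local Notation C := (R[i]).
Variables (m : nat) (d : 'I_m -> nat) (dE : nat) (X : 'I_m -> finType).
Variables (rho : op R (sysAE d dE)) (M : forall j : 'I_m, X j -> op R 'I_(d j)).
Hypothesis hrho : is_state rho.
Hypothesis hM : forall j, is_povm (@M j).

Lemma cq_blockE x e e' : cq_block rho (@M) x e e' =
  \sum_a \sum_a' rho (a, e) (a', e') * \prod_j M (x j) (a' j) (a j).
Proof. by rewrite /cq_block ptrace1_mul_id. Qed.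

Lemma psd_reindex (S T : finType) (h : S -> T) (A : op R T) :
  bijective h -> psd A -> psd (fun s s' => A (h s) (h s')).
Proof.
move=> hb pA v; case: (hb) => g hK gK.
have := pA (v \o g); rewrite (reindex h) /=; last exact: onW_bij.
suff -> : \sum_j \sum_j0 Num.conj (v (g (h j))) * A (h j) j0 * v (g j0) =
  \sum_i \sum_j Num.conj (v i) * A (h i) (h j) * v j by [].
apply: eq_bigr => i _; rewrite (reindex h) /=; last exact: onW_bij.
by apply: eq_bigr => j _; rewrite !hK.
Qed.

Lemma cq_block_psd x : psd (cq_block rho (@M) x).
Proof.
have fM : factored (optensorn (fun j : 'I_m => M (x j))).
  by apply: factored_tensorn => j; exact: (hM j).1.
(* [psd_ptrace_mul] traces out the second factor, so E is moved to the front. *)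
have pr : psd (fun z z' : 'I_dE * sysA d => rho (z.2, z.1) (z'.2, z'.1)).
  apply: (psd_reindex (h := fun z : 'I_dE * sysA d => (z.2, z.1))) hrho.1.
  by exists (fun z => (z.2, z.1)) => -[].
have := psd_ptrace_mul pr fM; congr psd.
by apply/funext => e; apply/funext => e'; rewrite cq_blockE.
Qed.

Lemma optrace_cq_block x : optrace (cq_block rho (@M) x) = (pX rho (@M) x)%:C.
Proof.
have -> : pX rho (@M) x = complex.Re (optrace (cq_block rho (@M) x)).
  by rewrite /pX /optrace /cq_block /ptrace1 sum_pair exchange_big.
rewrite RRe_real //.
by apply/ger0_real/sumr_ge0 => e _; exact/psd_diag_ge0/cq_block_psd.
Qed.

Lemma sum_pX : \sum_x pX rho (@M) x = 1.
Proof.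
apply: complexI; rewrite rmorph_sum /= -[RHS]hrho.2.
under eq_bigr => x _ do rewrite -optrace_cq_block /optrace.
rewrite exchange_big /= /optrace [RHS]sum_pair [RHS]exchange_big /=; apply: eq_bigr => e _.
under eq_bigr => x _ do rewrite cq_blockE.
rewrite exchange_big /=; apply: eq_bigr => a _.
rewrite exchange_big /=.
transitivity (\sum_a' rho (a, e) (a', e) * (a' == a)%:R); last by rewrite sum_delta_r.
apply: eq_bigr => a' _; rewrite -mulr_sumr; congr (_ * _).
rewrite (sum_dffun_prod (fun j (y : X j) => M y (a' j) (a j))).
rewrite (eq_bigr (fun j => (a' j == a j)%:R)) => [|j _]; last exact: (hM j).2.
rewrite prod_bool; congr (_%:R); congr nat_of_bool.
apply/forallP/eqP => [h|-> j]; last by rewrite eqxx.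
by apply/ffunP => j; exact/eqP/h.
Qed.

Lemma ptrace1_omegaE e e' : ptrace1 (omega' rho (@M)) e e' = \sum_x cq_block rho (@M) x e e'.
Proof. by rewrite /ptrace1; apply: eq_bigr => x _; rewrite /omega' /= eqxx. Qed.

Lemma eigdec_norm2 (T : finType) (A : op R T) lam u t : eigdec A lam u -> norm2 (u t) = 1.
Proof. by move=> [_ ho _]; apply: complexI; rewrite norm2E /inner ho eqxx. Qed.

Lemma single_letter :
  exists (lam : Xall X * 'I_dE -> R) (v : Xall X * 'I_dE -> 'I_dE -> C)
         (mu : 'I_dE -> R) (e : 'I_dE -> 'I_dE -> C),
  [/\ [/\ distribution_on lam, distribution_on mu, forall y, norm2 (v y) = 1 & orthobasis e],
      forall y y', y.1 = y'.1 -> y != y' -> inner (v y) (v y') = 0,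
      forall j, \sum_y lam y * cabs (inner (e j) (v y)) ^+ 2 = mu j,
      (SXgivenE rho (@M) = \sum_y Defs.eta (lam y) - \sum_j Defs.eta (mu j)) /\
      (forall x, pX rho (@M) x = \sum_i lam (x, i)) &
      forall x a b, cq_block rho (@M) x a b =
        \sum_i (lam (x, i))%:C * v (x, i) a * Num.conj (v (x, i) b)].
Proof.
have /choice[l0 /choice[u0 hu]] : forall x, exists l u, eigdec (cq_block rho (@M) x) l u.
  by move=> x; apply: eigdec_exists; apply: psd_hermitian; exact: cq_block_psd.
have pE : psd (ptrace1 (omega' rho (@M))).
  move=> w; under eq_bigr => i _ do under eq_bigr => j _ do rewrite ptrace1_omegaE mulr_sumr mulr_suml.
  under eq_bigr => i _ do rewrite exchange_big.
  by rewrite exchange_big /=; apply: sumr_ge0 => x _; exact: cq_block_psd.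
have [mu [e he]] := eigdec_exists (psd_hermitian pE).
pose lam (y : Xall X * 'I_dE) := l0 y.1 y.2.
pose v (y : Xall X * 'I_dE) : 'I_dE -> C := u0 y.1 y.2.
have lam0 y : 0 <= lam y by exact: eigdec_ge0 (cq_block_psd _) (hu y.1) _.
have blockE x a b : cq_block rho (@M) x a b =
    \sum_i (lam (x, i))%:C * v (x, i) a * Num.conj (v (x, i) b) by have [-> _ _] := hu x.
have pXE x : pX rho (@M) x = \sum_i lam (x, i).
  apply: complexI; rewrite -optrace_cq_block /optrace rmorph_sum /=.
  under eq_bigr => a _ do rewrite blockE.
  rewrite exchange_big /=; apply: eq_bigr => i _.
  transitivity ((lam (x, i))%:C * (norm2 (v (x, i)))%:C).
    rewrite norm2E /inner mulr_sumr; apply: eq_bigr => a _; ring.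
  by rewrite (eigdec_norm2 _ (hu x)) mulr1.
(* Both sides are the diagonal entry of rho_E at e j: the left one expands rho_E in the eigenvectors
   of all blocks, the right one in its own. *)
have wmu j : \sum_y lam y * cabs (inner (e j) (v y)) ^+ 2 = mu j.
  have [eE ho hc] := he.
  apply: complexI; rewrite rmorph_sum /=.
  transitivity (\sum_a \sum_b Num.conj (e j a) * ptrace1 (omega' rho (@M)) a b * e j b).
    rewrite sum_pair /=.
    under [RHS]eq_bigr => a _ do under eq_bigr => b _ do rewrite ptrace1_omegaE mulr_sumr mulr_suml.
    under [RHS]eq_bigr => a _ do rewrite exchange_big /=.
    rewrite [RHS]exchange_big /=; apply: eq_bigr => x _.
    under [RHS]eq_bigr => a _ do under eq_bigr => b _ do rewrite blockE mulr_sumr mulr_suml.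
    under [RHS]eq_bigr => a _ do rewrite exchange_big /=.
    rewrite [RHS]exchange_big /=; apply: eq_bigr => i _.
    rewrite rmorphM /= sqr_cabs inner_conj /inner big_distrlr /= mulr_sumr.
    apply: eq_bigr => a _; rewrite mulr_sumr; apply: eq_bigr => b _; ring.
  transitivity (\sum_s (s == j)%:R * ((mu s)%:C * \sum_a Num.conj (e j a) * e s a)).
    under eq_bigr => a _ do under eq_bigr => b _ do rewrite eE mulr_sumr mulr_suml.
    under eq_bigr => a _ do rewrite exchange_big /=.
    rewrite exchange_big /=; apply: eq_bigr => s _.
    rewrite -ho mulrCA [X in _ * X]mulrC big_distrlr /= mulr_sumr; apply: eq_bigr => a _.
    rewrite mulr_sumr; apply: eq_bigr => b _; ring.
  by rewrite sum_delta ho eqxx mulr1.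
have s1 : \sum_y lam y = 1.
  by rewrite sum_pair -sum_pX; apply: eq_bigr => x _; rewrite pXE.
have be : orthobasis e by have [_ ho hc] := he.
have v1 y : norm2 (v y) = 1 by exact: eigdec_norm2 (hu y.1).
have mu0 j : 0 <= mu j by exact: eigdec_ge0 pE he _.
exists lam, v, mu, e; split => //.
- split => //; split => //.
  under eq_bigr => j _ do rewrite -wmu.
  rewrite exchange_big /= -s1; apply: eq_bigr => y _; rewrite -mulr_sumr.
  rewrite -[RHS]mulr1; congr (_ * _); rewrite -(v1 y).
  by rewrite [in RHS](basis_expand (v y) be) norm2_comb.
- move=> [x i] [x' i'] /= <- ne; have [_ ho _] := hu x.
  rewrite /inner /v /= ho; move: ne; rewrite xpair_eqE eqxx /=.
  by move=> /negbTE ->.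
- split => //; rewrite /SXgivenE (vN_eigdec he); congr (_ - _).
  (* The eigenvectors of [omega'] are |x> tensor v (x, i). They are orthonormal across blocks thanks
     to the first factor, although the v alone are not. *)
  apply: (@vN_eigdec _ _ _ lam (fun y z => (y.1 == z.1)%:R * v y z.2)).
  split.
  + move=> [x a] [x' a']; rewrite /omega' /= sum_pair /=.
    transitivity (\sum_z (z == x)%:R * ((x == x')%:R * cq_block rho (@M) z a a')).
      by rewrite sum_delta; case: eqP => _; rewrite ?mul1r ?mul0r.
    apply: eq_bigr => z _; rewrite blockE !mulr_sumr; apply: eq_bigr => i _.
    rewrite rmorphM rmorph_nat; case: (eqVneq z x) => [->|_]; last by rewrite !(mul0r, mulr0).
    by ring.
  + move=> [x i] [x' i'] /=; rewrite sum_pair /=.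
    transitivity (\sum_z (z == x)%:R * ((x' == x)%:R * inner (v (x, i)) (v (x', i')))).
      apply: eq_bigr => z _; rewrite /inner !mulr_sumr; apply: eq_bigr => a _.
      rewrite rmorphM rmorph_nat (eq_sym z x); case: (eqVneq x z) => [->|_]; last by rewrite !(mul0r, mulr0).
      by ring.
    rewrite sum_delta xpair_eqE (eq_sym x'); case: (eqVneq x x') => [<-|_] /=; last by rewrite mul0r.
    by rewrite mul1r /inner /v /=; have [_ -> _] := hu x.
  + move=> [x a] [x' a'] /=; rewrite sum_pair /=.
    transitivity (\sum_z (z == x)%:R * ((x == x')%:R * \sum_i v (z, i) a * Num.conj (v (z, i) a'))).
      apply: eq_bigr => z _; rewrite !mulr_sumr; apply: eq_bigr => i _.
      rewrite rmorphM rmorph_nat; case: (eqVneq z x) => [->|_]; last by rewrite !(mul0r, mulr0).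
      by ring.
    rewrite sum_delta xpair_eqE; case: (eqVneq x x') => [_|_] /=; last by rewrite mul0r.
    by rewrite mul1r /v /=; have [_ _ ->] := hu x.
Qed.

End SingleLetter.

(** * Correctness and secrecy of the measure-and-hash protocol *)

Section ProtocolAnalysis.
Variable R : realType.
Local Notation C := (R[i]).
Variables (m : nat) (d : 'I_m -> nat) (dE : nat) (X : 'I_m -> finType).
Variables (rho : op R (sysAE d dE)) (M : forall j : 'I_m, X j -> op R 'I_(d j)).
Hypothesis hrho : is_state rho.
Hypothesis hM : forall j, is_povm (@M j).
Variables (n : nat) (K : finType) (L : 'I_m -> finType).
Local Notation Xn j := {ffun 'I_n -> X j}.
Local Notation Xs := {ffun 'I_n -> Xall X}.
Local Notation Lt := {dffun forall i, L i}.
Local Notation En := {ffun 'I_n -> 'I_dE}.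
Variables (f : forall j, Xn j -> L j) (dec : forall j, Xn j -> Lt -> K).
Local Notation P := (classical_protocol (@M) (@f) (@dec)).
Local Notation rhox := (cq_pow rho (@M) (n := n)).
Local Notation prob := (prodp (pX rho (@M)) (n := n)).

Definition messages (xs : Xs) : Lt := [ffun j => f (column j xs)].

Variables (g : Xs -> K) (bad : pred Xs).
Hypothesis dec_good : forall xs, ~~ bad xs ->
  forall j, dec (column j xs) (messages xs) = g xs.

Lemma messages_eq xs (l : Lt) : [forall j, f (column j xs) == l j] = (messages xs == l).
Proof.
apply/forallP/eqP => [h|<- j]; last by rewrite ffunE.
by apply/ffunP => j; rewrite ffunE; exact/eqP/h.
Qed.

Lemma pX_ge0 x : 0 <= pX rho (@M) x.
Proof.
rewrite -ler0c -optrace_cq_block //; apply: sumr_ge0 => e _.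
exact/psd_diag_ge0/cq_block_psd.
Qed.

Lemma pX_distribution : distribution_on (pX rho (@M)).
Proof. by split; [exact: pX_ge0 | exact: sum_pX]. Qed.

Lemma optrace_cq_pow xs : optrace (rhox xs) = (prob xs)%:C.
Proof.
rewrite /optrace /cq_pow -(bigA_distr_bigA (fun r a => cq_block rho (@M) (xs r) a a)).
rewrite rmorph_prod; apply: eq_bigr => r _ /=.
by rewrite -optrace_cq_block.
Qed.

Lemma cq_pow_psd xs : psd (rhox xs).
Proof.
apply: factored_psd.
by apply: (factored_tpow (A := fun r => cq_block rho (@M) (xs r))) => r; exact: cq_block_psd.
Qed.

(** On a string that is not bad, every player outputs [g xs], so the constant key tuple and the true
    messages already contribute its full probability; all other terms are nonnegative. *)
Lemma protocol_correct :
  1 - \sum_(xs | bad xs) prob xs <=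
  \sum_(k : {ffun 'I_m -> K} | [forall i, forall i', k i == k i'])
     \sum_(l : Lt) complex.Re (optrace (out_block (P := P) rho k l)).
Proof.
have p0 xs : 0 <= prob xs by apply: prodp_ge0; exact: pX_ge0.
rewrite -(sum_prodp n (sum_pX hrho hM)) (bigID bad) /= addrAC subrr add0r.
pose q k l xs : R := ([forall j, dec (column j xs) l == k j] && (messages xs == l))%:R.
have -> : \sum_(k : {ffun 'I_m -> K} | [forall i, forall i', k i == k i'])
     \sum_(l : Lt) complex.Re (optrace (out_block (P := P) rho k l)) =
   \sum_xs \sum_(k : {ffun 'I_m -> K} | [forall i, forall i', k i == k i'])
     \sum_(l : Lt) q k l xs * prob xs.
  rewrite [RHS]exchange_big /=; apply: eq_bigr => k _.
  rewrite [RHS]exchange_big /=; apply: eq_bigr => l _.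
  apply: complexI; rewrite RRe_real; last first.
    apply: ger0_real; apply: sumr_ge0 => e _; rewrite out_blockE.
    by apply: sumr_ge0 => xs _; rewrite mulr_ge0 //; exact/psd_diag_ge0/cq_pow_psd.
  rewrite rmorph_sum /= [LHS](eq_bigr _ (fun e _ => out_blockE _ _ _ e e)).
  rewrite exchange_big /=; apply: eq_bigr => xs _.
  by rewrite -mulr_sumr -/(optrace _) optrace_cq_pow rmorphM rmorph_nat messages_eq.
rewrite big_mkcond /=; apply: ler_sum => xs _.
have q0 k l : 0 <= q k l xs * prob xs by rewrite mulr_ge0.
case: ifP => [gx|_]; last by apply: sumr_ge0 => k _; apply: sumr_ge0.
rewrite (bigD1 [ffun=> g xs]) /=; last first.
  by apply/forallP => i; apply/forallP => i'; rewrite !ffunE.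
rewrite (bigD1 (messages xs)) //= -addrA /q eqxx andbT.
rewrite (_ : [forall j, _] = true) ?mul1r; last first.
  by apply/forallP => j; rewrite ffunE dec_good.
rewrite lerDl addr_ge0 //; first by apply: sumr_ge0 => l _; exact: q0.
by apply: sumr_ge0 => k _; apply: sumr_ge0 => l _; exact: q0.
Qed.

Section Ensemble.
Variables (lam : Xall X * 'I_dE -> R) (v : Xall X * 'I_dE -> 'I_dE -> C).
Hypothesis lam0 : forall y, 0 <= lam y.
Hypothesis v1 : forall y, norm2 (v y) = 1.
Hypothesis pXE : forall x, pX rho (@M) x = \sum_i lam (x, i).
Hypothesis blockE : forall x a b, cq_block rho (@M) x a b =
        \sum_i (lam (x, i))%:C * v (x, i) a * Num.conj (v (x, i) b).
Local Notation Yn := {ffun 'I_n -> Xall X * 'I_dE}.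
Local Notation proj := (@iid_project _ _ fst n).

Lemma sum_fst (V : nmodType) (S T : finType) (F : S * T -> V) (s : S) :
  \sum_(z | z.1 == s) F z = \sum_t F (s, t).
Proof.
rewrite big_mkcond sum_pair (bigD1 s) //= [X in _ + X]big1 ?addr0.
  by apply: eq_bigr => t _; rewrite eqxx.
by move=> s' /negbTE h; apply: big1 => t _; rewrite h.
Qed.

Lemma sum_cq_pow (G : Xs -> C) e e' :
  \sum_xs G xs * rhox xs e e' =
  \sum_(y : Yn) G (proj y) * ((prodp lam y)%:C * tpow v y e * Num.conj (tpow v y e')).
Proof.
rewrite [RHS](partition_big proj xpredT) //=; apply: eq_bigr => xs _.
transitivity (G xs * \sum_(y | proj y == xs) ((prodp lam y)%:C * tpow v y e * Num.conj (tpow v y e'))); last first.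
  by rewrite mulr_sumr; apply: eq_bigr => y /eqP ->.
congr (_ * _); rewrite /cq_pow.
under eq_bigr => r _ do rewrite blockE
  -(sum_fst (fun z => (lam z)%:C * v z (e r) * Num.conj (v z (e' r)))).
rewrite (bigA_distr_big_dep (fun r z => z.1 == xs r)
  (fun r z => (lam z)%:C * v z (e r) * Num.conj (v z (e' r)))).
apply: eq_big => [y|y _].
  apply/familyP/eqP => [h|<- r]; last by rewrite unfold_in ffunE.
  by apply/ffunP => r; rewrite ffunE; exact/eqP/(h r).
by rewrite !big_split /= rmorph_prod rmorph_prod.
Qed.

Lemma sum_prob (G : Xs -> R) :
  \sum_xs G xs * prob xs = \sum_(y : Yn) G (proj y) * prodp lam y.
Proof.
rewrite [RHS](partition_big proj xpredT) //=; apply: eq_bigr => xs _.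
transitivity (G xs * \sum_(y | proj y == xs) prodp lam y); last first.
  by rewrite mulr_sumr; apply: eq_bigr => y /eqP ->.
congr (_ * _); rewrite /prodp.
under eq_bigr => r _ do rewrite pXE -(sum_fst (fun z => lam z)).
rewrite (bigA_distr_big_dep (fun r z => z.1 == xs r) (fun r z => lam z)).
apply: eq_bigl => y.
apply/familyP/eqP => [h|<- r]; last by rewrite unfold_in ffunE.
by apply/ffunP => r; rewrite ffunE; exact/eqP/(h r).
Qed.

(** The actual joint state of the messages and E^n, used as [tau0]. *)
Definition classical_side : op R (Lt * En)%type :=
  fun u u' => (u.1 == u'.1)%:R * \sum_xs (messages xs == u.1)%:R * rhox xs u.2 u'.2.

Lemma classical_side_state : is_state classical_side.
Proof.
split=> [w|].
  suff -> : \sum_i \sum_j Num.conj (w i) * classical_side i j * w j =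
      \sum_xs \sum_e \sum_e' Num.conj (w (messages xs, e)) * rhox xs e e' * w (messages xs, e').
    by apply: sumr_ge0 => xs _; exact: (cq_pow_psd xs (fun e => w (messages xs, e))).
  rewrite sum_pair /=.
  transitivity (\sum_l \sum_e \sum_e' \sum_xs
     (l == messages xs)%:R * (Num.conj (w (l, e)) * rhox xs e e' * w (l, e'))).
    apply: eq_bigr => l _; apply: eq_bigr => e _; rewrite sum_pair exchange_big /=.
    apply: eq_bigr => e' _.
    transitivity (\sum_l' (l' == l)%:R * (Num.conj (w (l, e)) * (\sum_xs (messages xs == l)%:R * rhox xs e e') * w (l', e'))).
      by apply: eq_bigr => l' _; rewrite /classical_side /= (eq_sym l); ring.
    rewrite sum_delta mulr_sumr mulr_suml; apply: eq_bigr => xs _.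
    by rewrite eq_sym; ring.
  pose t l xs e e' := (l == messages xs)%:R * (Num.conj (w (l, e)) * rhox xs e e' * w (l, e')).
  transitivity (\sum_l \sum_e \sum_xs \sum_e' t l xs e e').
    by apply: eq_bigr => l _; apply: eq_bigr => e _; rewrite exchange_big.
  transitivity (\sum_l \sum_xs \sum_e \sum_e' t l xs e e').
    by apply: eq_bigr => l _; rewrite exchange_big.
  rewrite exchange_big /=; apply: eq_bigr => xs _.
  rewrite exchange_big /=; apply: eq_bigr => e _.
  rewrite exchange_big /=; apply: eq_bigr => e' _.
  by rewrite sum_delta.
rewrite /optrace sum_pair /=.
transitivity (\sum_xs \sum_e \sum_l (l == messages xs)%:R * rhox xs e e).
  rewrite [RHS]exchange_big /=.
  rewrite exchange_big /=; apply: eq_bigr => e _.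
  rewrite [RHS]exchange_big /=; apply: eq_bigr => l _.
  by rewrite /classical_side eqxx mul1r; apply: eq_bigr => xs _; rewrite eq_sym.
under eq_bigr => xs _ do under eq_bigr => e _ do rewrite sum_delta.
under eq_bigr => xs _ do rewrite -/(optrace _) optrace_cq_pow.
by rewrite -rmorph_sum (sum_prodp n (sum_pX hrho hM)).
Qed.

(* The analogue of hash_coef for the key actually output by player j0, which is
   computed from its decoded string. *)
Definition protocol_coef (j0 : 'I_m) (b : K * Lt) (xs : Xs) : R :=
  (messages xs == b.2)%:R * ((dec (column j0 xs) b.2 == b.1)%:R - #|K|%:R^-1).

Lemma protocol_diffE (j0 : 'I_m) u u' :
  opsub (keep_key j0 (Omega (P := P) rho)) (optensor (@unif R m d n P) classical_side) u u' =
  (u.1 == u'.1)%:R * ((u.2.1 == u'.2.1)%:R *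
    \sum_xs (protocol_coef j0 (u.1, u.2.1) xs)%:C * rhox xs u.2.2 u'.2.2).
Proof.
case: u => k [l e]; case: u' => k' [l' e']; rewrite /opsub /optensor /unif /classical_side /=.
have -> : keep_key j0 (Omega (P := P) rho) (k, (l, e)) (k', (l', e')) =
   (k == k')%:R * ((l == l')%:R * \sum_xs ((dec (column j0 xs) l == k) && (messages xs == l))%:R * rhox xs e e').
  rewrite /keep_key /Omega /=.
  transitivity (\sum_(x : {ffun 'I_m -> K} | x j0 == k) (x j0 == k')%:R * ((l == l')%:R * out_block (P := P) rho x l e e')).
    apply: eq_bigr => x xk.
    transitivity (\sum_y (y == x)%:R * ((y j0 == k')%:R * ((l == l')%:R * out_block (P := P) rho x l e e'))).
      rewrite big_mkcond /=; apply: eq_bigr => y _.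
      case: (eqVneq y x) => [->|_].
        rewrite mul1r (_ : [forall i, _] = true) ?andbT; last first.
          by apply/forallP => i; rewrite eqxx implybT.
        by case: (x j0 == k'); case: (l == l'); rewrite /= ?mul1r ?mul0r.
      by rewrite mul0r; case: ifP.
    by rewrite sum_delta.
  transitivity (\sum_(x : {ffun 'I_m -> K} | x j0 == k) (k == k')%:R * ((l == l')%:R * out_block (P := P) rho x l e e')).
    by apply: eq_bigr => x /eqP ->.
  rewrite -mulr_sumr -mulr_sumr; congr (_ * (_ * _)).
  rewrite [LHS](eq_bigr _ (fun x _ => out_blockE _ _ _ e e')).
  rewrite exchange_big /=; apply: eq_bigr => xs _; rewrite -mulr_suml; congr (_ * _).
  pose x0 : {ffun 'I_m -> K} := [ffun j => dec (column j xs) l].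
  transitivity (\sum_(x : {ffun 'I_m -> K}) (x == x0)%:R * ((x j0 == k) && (messages xs == l))%:R : C).
    rewrite big_mkcond /=; apply: eq_bigr => x _.
    have -> : [forall j, dec (column j xs) l == x j] = (x == x0).
      apply/forallP/eqP => [h|-> j]; last by rewrite ffunE.
      by apply/ffunP => j; rewrite ffunE; apply/esym/eqP/h.
    rewrite messages_eq.
    by case: (x j0 == k); case: (x == x0); case: (messages xs == l); rewrite /= ?mulr1 ?mulr0.
  by rewrite sum_delta ffunE.
rewrite mulrA mulrAC -!mulrA -mulrBr; congr (_ * _).
rewrite mulrC [X in _ - X]mulrCA -mulrBr; congr (_ * _).
rewrite mulr_sumr -sumrB; apply: eq_bigr => xs _.
rewrite /protocol_coef rmorphM rmorphB rmorph_nat rmorph_nat fmorphV rmorph_nat /=.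
by rewrite -mulnb natrM; ring.
Qed.

Lemma quad_inner (W : op R En) (u : En -> C) :
  \sum_e \sum_e' W e e' * (u e' * Num.conj (u e)) = inner u (apply_op W u).
Proof.
apply: eq_bigr => e _; rewrite /apply_op mulr_sumr; apply: eq_bigr => e' _; ring.
Qed.

Lemma protocol_secret (j0 : 'I_m) (Bd : R) : (0 < #|K|)%N ->
  (forall W : K * Lt -> op R En, (forall b, op_contraction (W b)) ->
     cabs (\sum_b \sum_(y : Yn) (hash_coef R messages g b (proj y) * prodp lam y)%:C
        * inner (tpow v y) (apply_op (W b) (tpow v y))) <= Bd) ->
  tnorm (opsub (keep_key j0 (Omega (P := P) rho)) (optensor (@unif R m d n P) classical_side))
    <= Bd + 2 * \sum_(xs | bad xs) prob xs.
Proof.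
move=> K0 hBd; set D := opsub _ _.
have hD : selfadjoint D.
  move=> u u'; rewrite /D !protocol_diffE !rmorphM !rmorph_nat (eq_sym u'.1) (eq_sym u'.2.1).
  case: eqP => [->|_]; last by rewrite !mul0r.
  case: eqP => [->|_]; last by rewrite !mul0r.
  congr (_ * (_ * _)); rewrite rmorph_sum /=; apply: eq_bigr => xs _.
  by rewrite [RHS]rmorphM /= conj_real -(psd_hermitian (cq_pow_psd xs)).
have [W [uW eW]] := tnorm_dual hD.
(* Reassociated so that (key, messages) is a single block index. The difference is block diagonal in
   it, so only the compressions [Wb b] of W enter the trace. *)
pose W2 : op R ((K * Lt) * En)%type := fun z z' => W (z.1.1, (z.1.2, z.2)) (z'.1.1, (z'.1.2, z'.2)).
pose Wb (b : K * Lt) : op R En := fun e e' => W2 (b, e) (b, e').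
have reB (F : K * (Lt * En) -> C) : \sum_z F z = \sum_(z : (K * Lt) * En) F (z.1.1, (z.1.2, z.2)).
  rewrite (reindex (fun z : (K * Lt) * En => (z.1.1, (z.1.2, z.2)))) //=.
  by exists (fun z => ((z.1, z.2.1), z.2.2)) => [[[? ?] ?]|[? [? ?]]].
have cWb b : op_contraction (Wb b).
  apply: contraction_block => i j.
  transitivity (\sum_k Num.conj (W k (i.1.1, (i.1.2, i.2))) * W k (j.1.1, (j.1.2, j.2))).
    by rewrite [RHS]reB.
  rewrite uW; congr (_ %:R); congr nat_of_bool.
  by case: i => [[? ?] ?]; case: j => [[? ?] ?]; rewrite /= !xpair_eqE andbA.
pose T b y := inner (tpow v y) (apply_op (Wb b) (tpow v y)).
have T1 b y : cabs (T b y) <= 1.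
  have := inner_contraction (tpow v y) (tpow v y) (cWb b).
  by rewrite norm2_tpow // sqrtr1 mulr1.
have eT : (tnorm D)%:C = \sum_b \sum_(y : Yn) (protocol_coef j0 b (proj y) * prodp lam y)%:C * T b y.
  rewrite eW reB sum_pair; apply: eq_bigr => b _.
  transitivity (\sum_e \sum_e' \sum_(y : Yn) (protocol_coef j0 b (proj y) * prodp lam y)%:C *
     (Wb b e e' * (tpow v y e' * Num.conj (tpow v y e)))).
    apply: eq_bigr => e _; rewrite reB sum_pair /=.
    transitivity (\sum_c (c == b)%:R * \sum_(e' : En) W (b.1, (b.2, e)) (c.1, (c.2, e'))
       * \sum_xs (protocol_coef j0 c xs)%:C * rhox xs e' e).
      apply: eq_bigr => c _; rewrite mulr_sumr; apply: eq_bigr => e' _.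
      rewrite /D protocol_diffE /=; case: c => k l; case: b => k' l' /=.
      by rewrite xpair_eqE -mulnb natrM; ring.
    rewrite sum_delta; apply: eq_bigr => e' _; rewrite sum_cq_pow mulr_sumr.
    apply: eq_bigr => y _; rewrite (rmorphM (real_complex R) (protocol_coef j0 b (proj y))).
    by rewrite /Wb /W2 /=; ring.
  under eq_bigr => e _ do rewrite exchange_big /=.
  rewrite exchange_big /=; apply: eq_bigr => y _.
  by rewrite /T -quad_inner mulr_sumr; apply: eq_bigr => e _; rewrite mulr_sumr.
apply: (@le_trans _ _ (cabs (tnorm D)%:C)); first by rewrite cabs_real ler_norm.
rewrite eT.
have -> : \sum_b \sum_(y : Yn) (protocol_coef j0 b (proj y) * prodp lam y)%:C * T b y =
   \sum_b \sum_(y : Yn) (hash_coef R messages g b (proj y) * prodp lam y)%:C * T b y +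
   \sum_b \sum_(y : Yn) ((protocol_coef j0 b (proj y) - hash_coef R messages g b (proj y)) * prodp lam y)%:C * T b y.
  rewrite -big_split; apply: eq_bigr => b _ /=; rewrite -big_split; apply: eq_bigr => y _ /=.
  by rewrite -mulrDl -rmorphD -mulrDl addrC subrK.
apply: le_trans (cabsD _ _) _; apply: lerD; first exact: hBd.
have lp0 y : 0 <= prodp lam (n := n) y by exact: prodp_ge0.
(* The terms 1/#K cancel. What remains is a difference of two key indicators on the true message,
   zero when decoding succeeds and of total mass at most 2 otherwise. *)
have cdiff xs : \sum_b `|protocol_coef j0 b xs - hash_coef R messages g b xs| <= 2 * (bad xs)%:R.
  have eb b : protocol_coef j0 b xs - hash_coef R messages g b xs =
     (messages xs == b.2)%:R * ((dec (column j0 xs) b.2 == b.1)%:R - (g xs == b.1)%:R).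
    by rewrite /protocol_coef /hash_coef; ring.
  under eq_bigr => b _ do rewrite eb.
  case: (boolP (bad xs)) => [_|hb]; last first.
    rewrite mulr0 big1 // => b _; case: eqP => [<-|_]; last by rewrite mul0r normr0.
    by rewrite dec_good // subrr mulr0 normr0.
  rewrite mulr1 sum_pair exchange_big /=.
  apply: (@le_trans _ _ (\sum_l (l == messages xs)%:R *
     \sum_k ((k == dec (column j0 xs) l)%:R * 1 + (k == g xs)%:R * 1) : R)).
    apply: ler_sum => l _; rewrite mulr_sumr; apply: ler_sum => k _.
    rewrite (eq_sym l) normrM normr_nat ler_wpM2l // !mulr1 !(eq_sym k).
    by apply: le_trans (ler_normB _ _) _; rewrite !normr_nat.
  by rewrite sum_delta big_split /= !sum_delta.
apply: le_trans (cabs_sum _ _) _.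
apply: (@le_trans _ _ (\sum_b \sum_(y : Yn) `|protocol_coef j0 b (proj y) - hash_coef R messages g b (proj y)| * prodp lam y)).
  apply: ler_sum => b _; apply: le_trans (cabs_sum _ _) _; apply: ler_sum => y _.
  rewrite cabsM cabs_real normrM (ger0_norm (lp0 y)).
  by rewrite ler_piMr // mulr_ge0.
rewrite exchange_big /=.
under eq_bigr => y _ do rewrite -mulr_suml.
apply: (@le_trans _ _ (\sum_(y : Yn) 2 * (bad (proj y))%:R * prodp lam y)).
  by apply: ler_sum => y _; rewrite ler_wpM2r.
under [leLHS]eq_bigr => y _ do rewrite -mulrA.
rewrite -mulr_sumr -(sum_prob (fun xs => (bad xs)%:R)) ler_wpM2l // [leRHS]big_mkcond /=.
by apply: ler_sum => xs _; case: (bad xs); rewrite ?mul1r ?mul0r.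
Qed.

End Ensemble.
End ProtocolAnalysis.

(** * Achievable rates *)

Section Rates.
Variable R : realType.
Local Open Scope classical_set_scope.

(** A nonnegative exponent keeps the power at least 1, so rounding down leaves a nonempty alphabet
    and loses at most a factor 2. *)
Lemma truncn_pow2 (x : R) : 0 <= x ->
  [/\ (0 < Num.truncn (pow2 x))%N, (Num.truncn (pow2 x))%:R <= pow2 x
    & pow2 x <= 2 * (Num.truncn (pow2 x))%:R].
Proof.
move=> x0; have /andP[lo hi] := truncn_itv (pow2_ge0 x).
have t0 : (0 < Num.truncn (pow2 x))%N.
  by rewrite truncn_ge_nat ?pow2_ge0 // -pow2_0 ler_pow2.
split => //; apply: le_trans (ltW hi) _.
have : 1 <= (Num.truncn (pow2 x))%:R :> R by rewrite ler1n.
by rewrite -natr1; lra.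
Qed.

(** Rounding costs at most one bit, hence 1/n in the rate. *)
Lemma key_rate_cvg (r : R) : 0 <= r ->
  (fun n : nat => log2 ((Num.truncn (pow2 (n%:R * r)))%:R : R) / n%:R) @ \oo --> r.
Proof.
move=> r0.
have hinv : (fun n : nat => (n%:R : R)^-1) @ \oo --> (0 : R).
  apply/gtr0_cvgV0; last exact: cvgr_idn.
  by near=> n; rewrite ltr0n; near: n; exact: nbhs_infty_gt.
have lo : (fun n : nat => r - (n%:R : R)^-1) @ \oo --> r.
  by rewrite -[X in _ --> X]subr0; apply: cvgB => //; exact: cvg_cst.
apply: (squeeze_cvgr _ lo (cvg_cst r)).
near=> n.
have n0 : 0 < n%:R :> R by rewrite ltr0n; near: n; exact: nbhs_infty_gt.
have [t0 t1 t2] := truncn_pow2 (mulr_ge0 (ltW n0) r0).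
have tR : 0 < (Num.truncn (pow2 (n%:R * r)))%:R :> R by rewrite ltr0n.
have l2 : log2 2 = 1 :> R by rewrite /log2 divff // gt_eqF ?ln2_gt0.
have mono (x y : R) : 0 < x -> x <= y -> log2 x <= log2 y.
  move=> x0 xy; rewrite /log2 ler_pM2r ?invr_gt0 ?ln2_gt0 //.
  by rewrite ler_ln ?posrE // (lt_le_trans x0).
apply/andP; split.
  rewrite ler_pdivlMr // mulrBl mulVf ?gt_eqF // mulrC.
  have := mono _ _ (pow2_gt0 _) t2; rewrite log2_pow2.
  rewrite /log2 lnM ?posrE // mulrDl -/(log2 2) -/(log2 _) l2; lra.
by rewrite ler_pdivrMr // [leRHS]mulrC -[leRHS]log2_pow2; exact: mono.
Unshelve. all: by end_near.
Qed.

Lemma pow2_sqrt (x : R) : Num.sqrt (pow2 x) = pow2 (x / 2).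
Proof.
have -> : pow2 x = pow2 (x / 2) ^+ 2 by rewrite expr2 -pow2D -splitr.
by rewrite sqrtr_sqr ger0_norm ?pow2_ge0.
Qed.

End Rates.

(** * From protocols to the capacity bound *)

Section Achievability.
Local Open Scope classical_set_scope.
Variable R : realType.
Local Notation C := (R[i]).
Variables (m : nat) (hm : (1 < m)%N) (d : 'I_m -> nat) (dE : nat) (X : 'I_m -> finType).
Variables (rho : op R (sysAE d dE)) (M : forall j : 'I_m, X j -> op R 'I_(d j)).
Hypothesis hrho : is_state rho.
Hypothesis hM : forall j, is_povm (@M j).
Local Notation p := (pX rho (@M)).

Lemma HX_marginal J : HX rho (@M) J = marginal_entropy p J.
Proof. exact: shannon_fibre. Qed.

Lemma HXcond_marginal I : HXcond rho (@M) I =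
  marginal_entropy p [set: 'I_m]%SET - marginal_entropy p (~: I)%SET.
Proof. by rewrite /HXcond !HX_marginal finset.setUCr. Qed.

(* In the definition of Rc, [set: 'I_m] is read in classical_set_scope. *)
Lemma proper_classical_setT (I : {set 'I_m}) :
  (I \proper [set: 'I_m]%classic) = (I \proper [set: 'I_m]%SET).
Proof.
suff -> : mem [set: 'I_m]%classic = mem [set: 'I_m]%SET :> mem_pred _ by [].
apply: (congr1 (@Mem _)); apply/funext => i /=.
have : i \in [set: 'I_m]%classic by rewrite in_setT.
by rewrite /in_mem /= => ->; rewrite [RHS]finset.in_setT.
Qed.

(** A singleton is a proper subset because there are at least two players, and its constraint bounds
    the rate below by a conditional entropy. *)
Lemma Rc_ge0 (Rt : 'I_m -> R) j : Rc rho (@M) Rt -> 0 <= Rt j.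
Proof.
move=> hR; have j1 : [set j]%SET \proper [set: 'I_m]%SET.
  by rewrite properEcard finset.subsetT cards1 cardsT card_ord.
have := hR [set j]%SET; rewrite proper_classical_setT => /(_ j1); rewrite big_set1; apply: le_trans.
by rewrite HXcond_marginal subr_ge0; apply: marginal_entropy_le; exact: pX_distribution.
Qed.

(** The factor 1/2 in the secrecy condition turns the bound e2 + 2 e1 of [protocol_secret] into e2/2
    + e1, so e1 + e2 covers both conditions. *)
Lemma eps_protocol_classical n (K : finType) (L : 'I_m -> finType)
    (f : forall j, {ffun 'I_n -> X j} -> L j)
    (dec : forall j, {ffun 'I_n -> X j} -> {dffun forall i, L i} -> K)
    (g : {ffun 'I_n -> Xall X} -> K) (bad : pred {ffun 'I_n -> Xall X})
    (lam : Xall X * 'I_dE -> R) (v : Xall X * 'I_dE -> 'I_dE -> C) (e1 e2 : R) :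
  (forall y, 0 <= lam y) -> (forall y, norm2 (v y) = 1) ->
  (forall x, p x = \sum_i lam (x, i)) ->
  (forall x a b, cq_block rho (@M) x a b =
        \sum_i (lam (x, i))%:C * v (x, i) a * Num.conj (v (x, i) b)) ->
  (0 < #|K|)%N ->
  (forall xs, ~~ bad xs -> forall j, dec j (column j xs) (messages f xs) = g xs) ->
  \sum_(xs | bad xs) prodp p xs <= e1 -> 0 <= e2 ->
  (forall W : K * {dffun forall i, L i} -> op R {ffun 'I_n -> 'I_dE},
     (forall b, op_contraction (W b)) ->
     cabs (\sum_b \sum_y (hash_coef R (messages f) g b (iid_project fst y) * prodp lam y)%:C
        * inner (tpow v y) (apply_op (W b) (tpow v y))) <= e2) ->
  eps_protocol (classical_protocol (@M) f dec) rho (e1 + e2).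
Proof.
move=> lam0 v1 pXE blockE K0 hdec he1 e20 he2.
split; first exact: classical_protocol_valid.
split.
  apply: le_trans (protocol_correct hrho hM hdec).
  rewrite lerB //; lra.
move=> j0 _; exists (classical_side rho (@M) f); split.
  exact: classical_side_state.
have := protocol_secret hrho hM hdec lam0 v1 pXE blockE j0 K0 he2.
rewrite ler_pdivrMr //; lra.
Qed.

(** A one-element key makes the capacity nonnegative, which settles the rates below zero. *)
Lemma achievable_zero : achievable rho 0.
Proof.
have [lam [v [mu [e [[dlam dmu v1 be] vo wmu [_ pXE] blockE]]]]] := single_letter hrho hM.
pose P n := @classical_protocol R m d X (@M) n unit (fun=> unit) (fun _ _ => tt) (fun _ _ _ => tt).
exists (fun=> 0), (fun=> 0 + 0), P; split.
- move=> n; apply: (@eps_protocol_classical n unit (fun=> unit) _ _ (fun=> tt) pred0 lam v) => //.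
  + exact: dlam.1.
  + by rewrite card_unit.
  + by rewrite big_pred0.
  + move=> W _; rewrite big1 => [|b _]; first by rewrite -[0]/(0%:C) cabs_real normr0.
    (* The only key has indicator 1 and 1/#K = 1, so every coefficient vanishes. *)
    apply: big1 => y _; rewrite /hash_coef card_unit invr1.
    by case: b => [[] l] /=; rewrite subrr mulr0 mul0r mul0r.
- by move=> n j; rewrite /= card_unit mulr0 powRr0.
- by rewrite addr0; exact: cvg_cst.
- have -> : (fun n => log2 (#|pK (P n)|%:R) / n%:R) = (fun=> 0 : R).
    by apply/funext => n; rewrite /= card_unit /log2 ln1 !mul0r.
  exact: cvg_cst.
Qed.

Lemma achievable_rate (Rt : 'I_m -> R) (r : R) : Rc rho (@M) Rt -> 0 <= r ->
  r + \sum_j Rt j < SXgivenE rho (@M) -> achievable rho r.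
Proof.
move=> hR r0 hr.
have [lam [v [mu [e [[dlam dmu v1 be] vo wmu [eS pXE] blockE]]]]] := single_letter hrho hM.
have dp := pX_distribution hrho hM.
set SXE := \sum_y Defs.eta (lam y) in eS; set SE := \sum_j Defs.eta (mu j) in eS.
(* 3 m delta is spent on the message rates and 2 delta on typicality, which
   leaves an exponent delta for the secrecy term. *)
pose delta : R := (SXgivenE rho (@M) - (r + \sum_j Rt j)) / (3 * m%:R + 3).
have m0 : 0 < 3 * m%:R + 3 :> R by rewrite ltr_wpDl // mulr_ge0.
have d0 : 0 < delta by rewrite divr_gt0 // subr_gt0.
have hdelta : r + \sum_j Rt j + delta * (3 * m%:R + 3) = SXE - SE.
  by rewrite /delta divfK ?gt_eqF // eS; ring.
pose a j := Rt j + 3 * delta.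
have a0 j : 0 <= a j by rewrite addr_ge0 ?(Rc_ge0 _ hR) // mulr_ge0 // ltW.
pose Lc n j := Num.truncn (pow2 (n%:R * a j)).
pose Kc n := Num.truncn (pow2 (n%:R * r)).
have nR (n : nat) : 0 <= n%:R :> R by [].
have hL n j := truncn_pow2 (mulr_ge0 (nR n) (a0 j)).
have hK n := truncn_pow2 (mulr_ge0 (nR n) r0).
have hRt (I : {set 'I_m}) : I \proper [set: 'I_m]%SET ->
    marginal_entropy p [set: 'I_m]%SET - marginal_entropy p (~: I)%SET <= \sum_(j in I) Rt j.
  by move=> hI; rewrite -HXcond_marginal; apply: hR; rewrite proper_classical_setT.
pose eps n := sw_bound p delta n +
  (secrecy_bound lam mu SXE SE delta n + Num.sqrt (pow2 (- (n%:R * delta)))).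
have main n : exists P : protocol R d n,
   [/\ eps_protocol P rho (eps n), forall j, #|pL P j| = Lc n j & #|pK P| = Kc n].
  pose L j : finType := 'I_(Lc n j).
  pose K : finType := 'I_(Kc n).
  have cK : #|K| = Kc n by rewrite card_ord.
  have K0 : (0 < #|K|)%N by rewrite cK; have [] := hK n.
  have hLc j : pow2 (n%:R * (Rt j + 3 * delta)) <= 2 * #|L j|%:R.
    by rewrite card_ord; have [] := hL n j.
  have [f hf] := slepian_wolf dp d0 hRt hLc.
  set bad := bin_error _ f in hf.
  pose ff j (x : {ffun 'I_n -> X j}) : L j := f j x.
  have [g hg] := iid_privacy SXE SE delta dlam dmu v1 be vo wmu (messages ff) K0.
  have /card_gt0P[k0 _] := K0.
  (* Any typical string compatible with the own column and the messages will do: a candidate other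
     than the true string would be exactly the competitor that [bin_error] excludes. *)
  pose dec j (x : {ffun 'I_n -> X j}) (l : {dffun forall i, L i}) : K :=
    if [pick xs | [&& typical p delta xs, column j xs == x
         & [forall i, f i (column i xs) == l i]]] is Some xs then g xs else k0.
  exists (classical_protocol (@M) ff dec); split; last 2 first.
  - by move=> j; rewrite /= card_ord.
  - by rewrite /= card_ord.
  apply: (@eps_protocol_classical n K L ff dec g bad lam v) => //.
  - exact: dlam.1.
  - move=> xs; rewrite /bad /bin_error negb_or negbK => /andP[txs /existsPn hxs] j.
    rewrite /dec; case: pickP => [xs' /and3P[txs' /eqP cj /forallP hl]|/(_ xs)].
      have [-> //|ne] := eqVneq xs' xs.
      have /negP[] := hxs xs'; rewrite txs' ne /=; apply/andP; split.
        by apply/existsP; exists j; rewrite cj.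
      by apply/forallP => i; have := hl i; rewrite ffunE.
    rewrite txs eqxx /= => /negP[]; apply/forallP => i.
    by rewrite ffunE.
  - rewrite addr_ge0 ?sqrtr_ge0 // mulr_ge0 // addr_ge0 ?sqrtr_ge0 //.
    exact: tail_ge0.
  - move=> W cW; apply: le_trans (hg W cW) _; rewrite lerD2l ler_wsqrtr //.
    apply: (@le_trans _ _ (pow2 (n%:R * r) * pow2 (\sum_j n%:R * a j) *
        pow2 (n%:R * (SE - SXE + 2 * delta)))).
      rewrite ler_wpM2r ?pow2_ge0 //; apply: ler_pM => //.
        by rewrite cK; have [] := hK n.
      rewrite card_dffun_prod pow2_sum; apply: ler_prod => j _.
      by rewrite ler0n card_ord; have [] := hL n j.
    rewrite -!pow2D ler_pow2 -mulr_sumr /a big_split /= sumr_const card_ord -[_ *+ m]mulr_natr.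
    rewrite -subr_ge0.
    set S := \sum_j Rt j in hdelta *.
    have -> : - (n%:R * delta) - (n%:R * r + n%:R * (S + 3 * delta * m%:R) + n%:R * (SE - SXE + 2 * delta))
      = n%:R * (SXE - SE - (r + S + delta * (3 * m%:R + 3))) by ring.
    by rewrite hdelta subrr mulr0.
pose P n := projT1 (cid (main n)); have hP n := projT2 (cid (main n)).
exists a, eps, P; split.
- by move=> n; have [] := hP n.
- move=> n j; have [_ -> _] := hP n.
  by rewrite pow2E; have [] := hL n j.
- have h1 := sw_bound_cvg dp d0.
  have h2 := secrecy_bound_cvg dlam dmu (erefl SXE) (erefl SE) d0.
  have h3 : (fun n : nat => Num.sqrt (pow2 (- (n%:R * delta)))) @ \oo --> (0 : R).
    have -> : (fun n : nat => Num.sqrt (pow2 (- (n%:R * delta)))) =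
              (fun n : nat => pow2 (- (n%:R * (delta / 2)))).
      by apply/funext => n; rewrite pow2_sqrt; congr pow2; ring.
    by apply: pow2_cvg0; rewrite divr_gt0.
  have -> : (0 : R) = 0 + (0 + 0) by rewrite !addr0.
  by apply: cvgD => //; exact: cvgD.
- have -> : (fun n => log2 (#|pK (P n)|%:R) / n%:R) =
    (fun n : nat => log2 ((Num.truncn (pow2 (n%:R * r)))%:R : R) / n%:R).
    by apply/funext => n; have [_ _ ->] := hP n.
  exact: key_rate_cvg.
Qed.

End Achievability.

Theorem theorem2 (R : realType) (m : nat) (hm : (1 < m)%N)
  (d : 'I_m -> nat) (dE : nat)
  (rho : op R (sysAE d dE)) (hrho : is_state rho)
  (X : 'I_m -> finType) (M : forall j : 'I_m, X j -> op R 'I_(d j))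
  (hM : forall j : 'I_m, is_povm (M j)) :
  ((SXgivenE rho M)%:E - RCO rho M <= Kni rho)%E.
Proof.
have Kni_ge r : achievable rho r -> (r%:E <= Kni rho)%E.
  by move=> hr; apply: ereal_sup_ubound; exists r.
have K0 := Kni_ge _ (achievable_zero hrho hM).
(* [RCO] is an infimum and need not be attained for this argument: a rate strictly below the bound
   leaves room for some tuple of the region, with slack that becomes delta. *)
have key (r : R) : (r%:E < (SXgivenE rho M)%:E - RCO rho M)%E -> (r%:E <= Kni rho)%E.
  move=> hr; have [r0|r0] := leP 0 r; last first.
    by apply: le_trans K0; rewrite lee_fin ltW.
  have hinf : (RCO rho M < (SXgivenE rho M - r)%:E)%E.
    case: (RCO rho M) hr => [x| |] //=; rewrite ?ltNyr //.
    by rewrite -EFinB !lte_fin => ?; lra.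
  have [_ [Rt hR <-]] := ereal_inf_lt hinf.
  rewrite lte_fin => hlt; apply: Kni_ge.
  apply: (achievable_rate hm hrho hM hR r0); lra.
(* If the bound exceeded a finite capacity k, a rate between them would contradict [key]: the
   midpoint for a finite bound, k + 1 for an infinite one. *)
case: (Kni rho) K0 key => [k| |] K0 key; rewrite ?leey //.
case: ((SXgivenE rho M)%:E - RCO rho M)%E key => [x| |] key; rewrite ?leNye //.
  rewrite lee_fin leNgt; apply/negP => kx.
  have := key ((k + x) / 2); rewrite lte_fin lee_fin => h.
  have : (k + x) / 2 <= k by apply: h; lra.
  lra.
by have := key (k + 1); rewrite ltry lee_fin gerDl ler10 => /(_ isT).
Qed.
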